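(* Let $L$ be a first-order language as described in the context. For every query $Q$ over $L$, every run of the Solved Form Algorithm started on $Q$ terminates after finitely many steps, and the query $Q'$ it returns is in solved form and is equivalent to $Q$, i.e. $Q' \approx Q$.
   Context: Fix a first-order language $L$ with equality, whose set of function symbols contains at least one constant (constants are $0$-ary function symbols); the propositional constants $\mathit{True}$ and $\mathit{False}$ are formulas. $\mathrm{FEA}(L)$ (free equality axioms) is the theory consisting of: $f(x_1,\dots,x_n)=f(y_1,\dots,y_n)\leftrightarrow x_1=y_1\wedge\dots\wedge x_n=y_n$ for each $n$-ary function symbol $f$; $f(x_1,\dots,x_n)=g(y_1,\dots,y_m)\leftrightarrow\mathit{False}$ for distinct function symbols $f,g$; $x=t\leftrightarrow\mathit{False}$ for each variable $x$ and term $t$ with $x\not\equiv t$ and $x$ occurring in $t$. A pre-interpretation $J$ consists of a nonempty domain $U_J$ and interpretations of the function symbols; $=$ is interpreted as identity. A $J$-valuation is a map from variables to $U_J$ (extended homomorphically to terms); $V_J$ is the set of $J$-valuations. The $J$-base $B_J$ is the set of all $p(d_1,\dots,d_n)$ with $p$ a non-equality predicate symbol and $d_i\in U_J$; an interpretation based on $J$ is a subset of $B_J$. A query is a formula built from $\mathit{True}$, $\mathit{False}$, equations $s=t$ and atoms $p(s_1,\dots,s_n)$ ($p$ not $=$) using only $\wedge$ and $\exists$. $|Q|$ denotes the number of atom occurrences in $Q$. A multiinterpretation based on $J$ is a finite sequence of interpretations based on $J$. The solution set $\mathrm{Sol}_J(Q,\bar I)$ (for $\bar I$ of length $|Q|$)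 is defined by: $\mathrm{Sol}_J(\mathit{True},\varepsilon)=V_J$, $\mathrm{Sol}_J(\mathit{False},\varepsilon)=\emptyset$; $\mathrm{Sol}_J(s=t,\varepsilon)=\{h: h(s)=h(t)\}$; for an atom $A$, $\mathrm{Sol}_J(A,(I))=\{h: h(A)\in I\}$; $\mathrm{Sol}_J(Q_1\wedge Q_2,\bar I_1\bar I_2)=\mathrm{Sol}_J(Q_1,\bar I_1)\cap\mathrm{Sol}_J(Q_2,\bar I_2)$ with $|\bar I_i|=|Q_i|$; $\mathrm{Sol}_J((\exists x)Q,\bar I)=\{h: h[x\mapsto d]\in\mathrm{Sol}_J(Q,\bar I)$ for some $d\in U_J\}$. $Q\approx Q'$ means $|Q|=|Q'|$ and $\mathrm{Sol}_J(Q,\bar I)=\mathrm{Sol}_J(Q',\bar I)$ for every pre-interpretation $J$ that is a model of $\mathrm{FEA}(L)$ and every multiinterpretation $\bar I$ of length $|Q|$ based on $J$. A query is in solved form if it is $\mathit{True}$ or $\mathit{False}$, or of the form $(\exists z_1)\dots(\exists z_k)(x_1=s_1\wedge\dots\wedge x_n=s_n\wedge A_1\wedge\dots\wedge A_m)$ where (i) the $x_i$ and $z_j$ are pairwise distinct variables, (ii) no $x_i$ occurs in any $s_j$ or in any atom $A_l$, (iii) each $z_j$ occurs in the conjunction, (iv) $z_j\not\equiv s_i$ for all $i,j$. $G_x[t]$ denotes the result of replacing the free occurrences of $x$ in $G$ by $t$; $(\exists\bar y)$ abbreviates $(\exists y_1)\dots(\exists y_k)$. Solved Form Algorithm: starting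 from $Q$, nondeterministically apply any of the following steps to the current query: (1) replace an equation $f(s_1,\dots,s_n)=f(t_1,\dots,t_n)$ by $s_1=t_1\wedge\dots\wedge s_n=t_n$; (2) replace $f(s_1,\dots,s_n)=g(t_1,\dots,t_m)$, $f,g$ distinct, by $\mathit{False}$; (3) replace $x=t$ by $\mathit{False}$ if $x\not\equiv t$ and $x$ occurs in $t$; (4) replace $x=x$ by $\mathit{True}$; for a subquery $(\exists\bar y)(Q'\wedge x=t\wedge Q'')$ with $Q',Q''$ conjunctions of equations and atoms, $x\not\equiv t$ and $x$ not occurring in $t$: (5) replace it by $(\exists\bar y)(Q'_x[t]\wedge x=t\wedge Q''_x[t])$ if $x$ is not among $\bar y$ and $x$ has another free occurrence in $Q'$ or $Q''$; (6) replace it by $(\exists\bar y)(Q'_x[t]\wedge\mathit{True}\wedge Q''_x[t])$ if $x$ is among $\bar y$; (7) replace $(\exists\bar y)(Q'\wedge t=x\wedge Q'')$ by $(\exists\bar y)(Q'\wedge x=t\wedge Q'')$ if $t$ is not a variable, or $t$ is a variable distinct from $x$ not among $\bar y$ while $x$ is among $\bar y$; (8) replace $(\exists\bar y')(\exists y)(\exists\bar y'')Q$ by $(\exists\bar y')(\exists\bar y'')Q$ if $y$ is not free in $(\exists\bar y'')Q$; (9) replace $(\exists\bar y_1)Q_1\wedge(\exists\bar y_2)Q_2$ (with $\bar y_1$ or $\bar y_2$ nonempty) by $(\exists\bar z_1)(\exists\bar z_2)(R_1\wedge R_2)$, where $(\exists\bar z_i)R_i$ is a variant (renaming of bound variables)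 of $(\exists\bar y_i)Q_i$ such that no variable of $\bar z_2$ is free in $R_1$ and no variable of $\bar z_1$ is free in $R_2$; (10) replace $A\wedge s=t$ by $s=t\wedge A$, where $A$ is an atom; (11) delete any occurrence of $\mathit{True}$; (12) replace the query by $\mathit{False}$ if it contains an occurrence of $\mathit{False}$. The algorithm stops, returning the current query, when no step can be applied or when $\mathit{False}$ has been returned.
   Formalization: If False is returned for a Q with atoms, Q' ≈ Q (impossible, as |Q'| ≠ |Q|) is replaced by: Q has no solutions in any model of FEA(L). Steps 5–7 act only on whole conjunctions, as on arbitrary parts they can loop; step 7 also applies when x occurs in t. *)

(* Defs.v *)
From mathcomp Require Import all_boot.
From mathcomp Require Import classical_sets.
From Stdlib Require Import Relations.

Set Implicit Arguments.
Unset Strict Implicit.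
Unset Printing Implicit Defensive.

(* Equality is a logical symbol, so [psym] lists the other predicate symbols. *)
Record language := Language {
  fsym : Type;
  far : fsym -> nat;
  psym : Type;
  par : psym -> nat;
  has_constant : exists c : fsym, far c = 0 }.

(* Variables are natural numbers. *)
Inductive term (L : language) : Type :=
| Var of nat
| App (f : fsym L) of {ffun 'I_(far f) -> term L}.

Inductive query (L : language) : Type :=
| QTrue
| QFalse
| Eq of term L & term L
| Atom (p : psym L) of {ffun 'I_(par p) -> term L}
| And of query L & query L
| Ex of nat & query L.

Arguments Var {L}.
Arguments QTrue {L}.
Arguments QFalse {L}.

Section Syntax.
Variable L : language.
Implicit Types (t : term L) (Q : query L) (x y : nat).

Fixpoint occ_term x t : bool :=
  match t with
  | Var y => x == y
  | App f a => [exists i, occ_term x (a i)]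
  end.

Fixpoint free x Q : bool :=
  match Q with
  | QTrue | QFalse => false
  | Eq s t => occ_term x s || occ_term x t
  | Atom p a => [exists i, occ_term x (a i)]
  | And Q1 Q2 => free x Q1 || free x Q2
  | Ex y Q1 => (x != y) && free x Q1
  end.

(* Any occurrence: free, bound or binding. *)
Fixpoint occ x Q : bool :=
  match Q with
  | QTrue | QFalse => false
  | Eq s t => occ_term x s || occ_term x t
  | Atom p a => [exists i, occ_term x (a i)]
  | And Q1 Q2 => occ x Q1 || occ x Q2
  | Ex y Q1 => (x == y) || occ x Q1
  end.

Fixpoint subst_term x t s : term L :=
  match s with
  | Var y => if y == x then t else Var y
  | App f a => App [ffun i => subst_term x t (a i)]
  end.

(* Replacement of the free occurrences of [x]; it does not avoid capture. *)
Fixpoint subst x t Q : query L :=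
  match Q with
  | QTrue => QTrue
  | QFalse => QFalse
  | Eq s1 s2 => Eq (subst_term x t s1) (subst_term x t s2)
  | Atom p a => Atom [ffun i => subst_term x t (a i)]
  | And Q1 Q2 => And (subst x t Q1) (subst x t Q2)
  | Ex y Q1 => Ex y (if y == x then Q1 else subst x t Q1)
  end.

Fixpoint natoms Q : nat :=
  match Q with
  | QTrue | QFalse | Eq _ _ => 0
  | Atom _ _ => 1
  | And Q1 Q2 => natoms Q1 + natoms Q2
  | Ex _ Q1 => natoms Q1
  end.

Fixpoint has_false Q : bool :=
  match Q with
  | QFalse => true
  | QTrue | Eq _ _ | Atom _ _ => false
  | And Q1 Q2 => has_false Q1 || has_false Q2
  | Ex _ Q1 => has_false Q1
  end.

Definition is_atom Q : bool := if Q is Atom _ _ then true else false.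
Definition is_eq Q : bool := if Q is Eq _ _ then true else false.
Definition literal Q : bool := is_eq Q || is_atom Q.
Definition is_var t : bool := if t is Var _ then true else false.

Definition exs (ys : seq nat) Q : query L := foldr (@Ex L) Q ys.

(* The empty conjunction is [QTrue]. *)
Fixpoint conj (s : seq (query L)) : query L :=
  match s with
  | [::] => QTrue
  | [:: Q] => Q
  | Q :: s' => And Q (conj s')
  end.

(* Rewriting one subquery. The flag tells the rule whether the subquery is an
   operand of a conjunction, i.e. only a part of a larger conjunction. *)
Inductive ctx (R : bool -> query L -> query L -> Prop) :
    bool -> query L -> query L -> Prop :=
| ctx_here c Q Q' : R c Q Q' -> ctx R c Q Q'
| ctx_andl c Q Q' P : ctx R true Q Q' -> ctx R c (And Q P) (And Q' P)
| ctx_andr c Q Q' P : ctx R true Q Q' -> ctx R c (And P Q) (And P Q')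
| ctx_ex c x Q Q' : ctx R false Q Q' -> ctx R c (Ex x Q) (Ex x Q').

Inductive assoc_rule (c : bool) : query L -> query L -> Prop :=
| AssocRule Q1 Q2 Q3 :
    assoc_rule c (And (And Q1 Q2) Q3) (And Q1 (And Q2 Q3)).

(* Conjunctions are written without brackets: the algorithm and the solved
   forms are understood up to associativity of [And]. *)
Definition assoc : query L -> query L -> Prop :=
  clos_refl_sym_trans (query L) (ctx assoc_rule false).

Inductive rename_rule (c : bool) : query L -> query L -> Prop :=
| RenameRule x y Q : ~~ occ y Q ->
    rename_rule c (Ex x Q) (Ex y (subst x (Var y) Q)).

Definition variant : query L -> query L -> Prop :=
  clos_refl_sym_trans (query L) (ctx rename_rule false).

(* In [Substitute], [Eliminate] and [Orient] the matrix has to be a whole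
   unbracketed conjunction: if the quantifier prefix [ys] is empty, the subquery
   must not be an operand of a larger conjunction. Rewriting arbitrary segments
   of a conjunction would loop: x = y, p(x), y = x becomes x = y, p(y), y = x
   and then x = y, p(x), y = x again. The prefix [ys] need not be maximal. *)
Inductive rule (c : bool) : query L -> query L -> Prop :=
| Decompose (f : fsym L) (s t : {ffun 'I_(far f) -> term L}) :
    rule c (Eq (App s) (App t))
           (conj [seq Eq (s i) (t i) | i <- enum 'I_(far f)])
| Clash (f g : fsym L) (s : {ffun 'I_(far f) -> term L})
    (t : {ffun 'I_(far g) -> term L}) :
    f <> g -> rule c (Eq (App s) (App t)) QFalse
| OccursCheck x t :
    t <> Var x -> occ_term x t -> rule c (Eq (Var x) t) QFalse
| Reflexive x : rule c (Eq (Var x) (Var x)) QTrue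
| Substitute ys P x t S :
    (c -> ys <> [::]) -> all literal (P ++ S) ->
    t <> Var x -> ~~ occ_term x t ->
    x \notin ys -> has (free x) (P ++ S) ->
    rule c (exs ys (conj (P ++ Eq (Var x) t :: S)))
           (exs ys (conj (map (subst x t) P ++
                          Eq (Var x) t :: map (subst x t) S)))
| Eliminate ys P x t S :
    (c -> ys <> [::]) -> all literal (P ++ S) ->
    t <> Var x -> ~~ occ_term x t ->
    x \in ys ->
    rule c (exs ys (conj (P ++ Eq (Var x) t :: S)))
           (exs ys (conj (map (subst x t) P ++
                          QTrue :: map (subst x t) S)))
| Orient ys P x t S :
    (c -> ys <> [::]) -> all literal (P ++ S) ->
    (~~ is_var t \/
     exists z, [/\ t = Var z, z <> x, z \notin ys & x \in ys]) ->
    rule c (exs ys (conj (P ++ Eq t (Var x) :: S)))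
           (exs ys (conj (P ++ Eq (Var x) t :: S)))
| DropQuantifier y Q : ~~ free y Q -> rule c (Ex y Q) Q
| Prenex ys1 Q1 ys2 Q2 zs1 R1 zs2 R2 :
    ys1 <> [::] \/ ys2 <> [::] ->
    size zs1 = size ys1 -> variant (exs ys1 Q1) (exs zs1 R1) ->
    size zs2 = size ys2 -> variant (exs ys2 Q2) (exs zs2 R2) ->
    (forall z, z \in zs2 -> ~~ free z R1) ->
    (forall z, z \in zs1 -> ~~ free z R2) ->
    rule c (And (exs ys1 Q1) (exs ys2 Q2)) (exs zs1 (exs zs2 (And R1 R2)))
| MoveAtom A s t : is_atom A -> rule c (And A (Eq s t)) (And (Eq s t) A)
| DeleteTrueL Q : rule c (And QTrue Q) Q
| DeleteTrueR Q : rule c (And Q QTrue) Q.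

(* No step starts from [QFalse]: the algorithm stops there. *)
Definition alg_step Q Q' : Prop :=
  Q <> QFalse /\
  ((exists2 Q1, assoc Q Q1 & ctx rule false Q1 Q') \/
   (has_false Q /\ Q' = QFalse)).

Definition run : query L -> query L -> Prop :=
  clos_refl_trans (query L) alg_step.

Definition returned Q : Prop := forall Q', ~ alg_step Q Q'.

(* [E] lists the pairs (x_i, s_i) and [As] the atoms A_l. *)
Definition solved_form Q : Prop :=
  Q = QTrue \/ Q = QFalse \/
  exists (zs : seq nat) (E : seq (nat * term L)) (As : seq (query L)),
    let M := conj ([seq Eq (Var e.1) e.2 | e <- E] ++ As) in
    [/\ assoc Q (exs zs M) /\ all is_atom As,
        uniq (map fst E ++ zs),
        forall x, x \in map fst E ->
          ~~ has (occ_term x) (map snd E) && ~~ has (free x) As,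
        forall z, z \in zs -> free z M
      & forall z i, z \in zs -> i < size E ->
          nth (Var 0) (map snd E) i <> Var z].

Record preinterp := PreInterp {
  dom :> Type;
  dom_inhabited : inhabited dom;
  fint : forall f : fsym L, {ffun 'I_(far f) -> dom} -> dom }.

Definition valuation (J : preinterp) := nat -> J.

Fixpoint eval (J : preinterp) (h : valuation J) t : J :=
  match t with
  | Var x => h x
  | App f a => fint [ffun i => eval h (a i)]
  end.

Definition model_FEA (J : preinterp) : Prop :=
  [/\ forall (f : fsym L) (a b : {ffun 'I_(far f) -> J}),
        fint a = fint b <-> forall i, a i = b i,
      forall (f g : fsym L) (a : {ffun 'I_(far f) -> J})
        (b : {ffun 'I_(far g) -> J}),
        f <> g -> (fint a = fint b <-> False)
    & forall x t, t <> Var x -> occ_term x t ->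
        forall h : valuation J, h x = eval h t <-> False].

Definition base (J : preinterp) : Type :=
  {p : psym L & {ffun 'I_(par p) -> J}}.

Definition interp (J : preinterp) : Type := set (base J).

Local Open Scope classical_set_scope.

(* Meaningful for sequences of interpretations of length [natoms Q]. *)
Fixpoint Sol (J : preinterp) Q (I : seq (interp J)) : set (valuation J) :=
  match Q with
  | QTrue => setT
  | QFalse => set0
  | Eq s t => [set h | eval h s = eval h t]
  | Atom p a =>
      if I is [:: I0]
      then [set h | I0 (existT _ p [ffun i => eval h (a i)])]
      else set0
  | And Q1 Q2 =>
      Sol Q1 (take (natoms Q1) I) `&` Sol Q2 (drop (natoms Q1) I)
  | Ex x Q1 =>
      [set h | exists d : J, Sol Q1 I (fun y => if y == x then d else h y)]
  end.

Definition equivq Q Q' : Prop :=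
  natoms Q = natoms Q' /\
  forall J : preinterp, model_FEA J ->
  forall I : seq (interp J), size I = natoms Q -> Sol Q I = Sol Q' I.

Definition unsatisfiable Q : Prop :=
  forall J : preinterp, model_FEA J ->
  forall I : seq (interp J), size I = natoms Q -> Sol Q I = set0.

End Syntax.

(* Main.v *)
(* Termination: flattening conjunctions turns a query into a tree of groups of
   literals separated by quantifiers. A lexicographic measure decreases at each
   step. Dropping a quantifier, or pulling one over a conjunct that contains
   another one, decreases the number of quantifiers plus the number of pairs of
   quantifiers neither of which is in the scope of the other. Pulling a
   quantifier over quantifier-free conjuncts lowers their weight times the number
   of quantifiers below their group. The remaining steps are measured group by
   group: number of variables not solved by an equation x = f(..), then weight of
   the literals, and then, for the steps that only exchange variables, the
   binding depth. An equation between variables can be turned around only if this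
   brings the more deeply bound variable to the left, hence substituting variables
   for variables and turning equations around decreases, lexicographically from
   the innermost depth outwards, the number of unsolved variables and the number
   of occurrences of less deeply bound variables.
   Every step preserves the solution sets, and a query on which no step applies is
   a quantifier prefix followed by equations and then atoms, in which each
   condition of solved form is enforced by some step that does not apply. *)
From mathcomp Require Import all_boot zify.
From mathcomp Require Import boolp classical_sets.
From Stdlib Require Import Relations.
Require Import Defs.

Set Implicit Arguments.
Unset Strict Implicit.
Unset Printing Implicit Defensive.

(** * Variables and sizes of terms and literals *)

Section Terms.
Variable L : language.
Implicit Types (t s : term L) (Q : query L) (x y z : nat).

(** Arguments sit inside a finite function, so the induction hypothesis for each of them comes from
    a direct fixpoint. *)
Lemma term_ind_ffun (P : term L -> Prop) :
  (forall x, P (Var x)) ->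
  (forall (f : fsym L) (a : {ffun 'I_(far f) -> term L}),
     (forall i, P (a i)) -> P (App a)) ->
  forall t, P t.
Proof.
move=> PV PA; fix IH 1 => -[x|f a]; first exact: PV.
by apply: PA => i; apply: IH.
Qed.

Fixpoint tvars t : seq nat :=
  match t with
  | Var x => [:: x]
  | App f a => flatten [seq tvars (a i) | i <- enum 'I_(far f)]
  end.

Fixpoint tsize t : nat :=
  match t with
  | Var x => 1
  | App f a => 2 + sumn [seq tsize (a i) | i <- enum 'I_(far f)]
  end.

Definition lvars Q : seq nat :=
  match Q with
  | Eq s t => tvars s ++ tvars t
  | Atom p a => flatten [seq tvars (a i) | i <- enum 'I_(par p)]
  | _ => [::]
  end.

(* The left-hand side counts twice and [App] adds 2, so that both decomposing an
   equation and turning [f(..) = x] around decrease the size. *)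
Definition lsize Q : nat :=
  match Q with
  | Eq s t => 2 * tsize s + tsize t
  | Atom p a => 1 + sumn [seq tsize (a i) | i <- enum 'I_(par p)]
  | _ => 1
  end.

Lemma mem_tvars x t : (x \in tvars t) = occ_term x t.
Proof.
elim/term_ind_ffun: t => [y|f a IH] /=; first by rewrite inE.
apply/flatten_mapP/existsP => [[i _ xi]|[i xi]]; exists i; rewrite ?mem_enum -?IH //.
by rewrite IH.
Qed.

Lemma mem_lvars x Q : literal Q -> (x \in lvars Q) = free x Q.
Proof.
case: Q => //= [s t|p a] _; first by rewrite mem_cat !mem_tvars.
apply/flatten_mapP/existsP => [[i _ xi]|[i xi]]; exists i; rewrite ?mem_enum -?mem_tvars //.
by rewrite mem_tvars.
Qed.

Lemma sumn_flatten_map (T I : Type) (p : pred T) (F : I -> seq T) (r : seq I) :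
  count p (flatten [seq F i | i <- r]) = sumn [seq count p (F i) | i <- r].
Proof. by rewrite count_flatten -map_comp. Qed.

Lemma leq_sumn_map (I : Type) (F G : I -> nat) (r : seq I) :
  (forall i, F i <= G i) -> sumn [seq F i | i <- r] <= sumn [seq G i | i <- r].
Proof. by move=> FG; elim: r => //= i r; apply: leq_add. Qed.

Lemma count_tvars_leq (p : pred nat) t : count p (tvars t) <= tsize t.
Proof.
elim/term_ind_ffun: t => [x|f a IH] /=; first by case: (p x).
rewrite sumn_flatten_map; apply: leq_trans (leq_addl _ _).
exact: leq_sumn_map.
Qed.

Lemma tsize_gt0 t : 0 < tsize t.
Proof. by case: t. Qed.

(** Exact counts rather than membership are tracked, because a solved variable has to occur exactly
    once in its group. *)
Lemma count_subst_term y x t s :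
  count_mem y (tvars (subst_term x t s)) =
  (y != x) * count_mem y (tvars s) + count_mem x (tvars s) * count_mem y (tvars t).
Proof.
elim/term_ind_ffun: s => [z|f a IH] /=.
  case: (altP (z =P x)) => [->|zx] /=; first by case: (altP (x =P y)) => [->|]; rewrite ?eqxx; lia.
  by case: (altP (z =P y)) => [<-|]; rewrite ?zx; lia.
rewrite !sumn_flatten_map; elim: (enum _) => [|i r IHr] /=; first by rewrite muln0.
by rewrite ffunE IH IHr mulnDr mulnDl addnACA.
Qed.

Lemma count_subst_literal y x t Q : literal Q ->
  count_mem y (lvars (subst x t Q)) =
  (y != x) * count_mem y (lvars Q) + count_mem x (lvars Q) * count_mem y (tvars t).
Proof.
case: Q => //= [s u|p a] _; first by rewrite !count_cat !count_subst_term mulnDr mulnDl addnACA.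
rewrite !sumn_flatten_map; elim: (enum _) => [|i r IHr] /=; first by rewrite muln0.
by rewrite ffunE count_subst_term IHr mulnDr mulnDl addnACA.
Qed.

Definition rename x y := fun z => if z == x then y else z.

Lemma tvars_rename x y t :
  tvars (subst_term x (Var y) t) = map (rename x y) (tvars t).
Proof.
elim/term_ind_ffun: t => [z|f a IH] /=; first by rewrite /rename; case: ifP.
by rewrite map_flatten -map_comp; congr flatten; apply: eq_map => i /=; rewrite ffunE.
Qed.

Lemma tsize_rename x y t : tsize (subst_term x (Var y) t) = tsize t.
Proof.
elim/term_ind_ffun: t => [z|f a IH] /=; first by case: ifP.
by congr _.+2; congr sumn; apply: eq_map => i /=; rewrite ffunE.
Qed.

Lemma lvars_rename x y Q : literal Q ->
  lvars (subst x (Var y) Q) = map (rename x y) (lvars Q).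
Proof.
case: Q => //= [s t|p a] _; first by rewrite map_cat !tvars_rename.
by rewrite map_flatten -map_comp; congr flatten; apply: eq_map => i /=; rewrite ffunE tvars_rename.
Qed.

Lemma lsize_rename x y Q : lsize (subst x (Var y) Q) = lsize Q.
Proof.
case: Q => //= [s t|p a]; first by rewrite !tsize_rename.
by congr _.+1; congr sumn; apply: eq_map => i /=; rewrite ffunE tsize_rename.
Qed.

Lemma subst_term_id x t s : ~~ occ_term x s -> subst_term x t s = s.
Proof.
elim/term_ind_ffun: s => [z|f a IH] /=; first by rewrite eq_sym => /negbTE ->.
move=> /existsPn xa; congr App; apply/ffunP => i; rewrite ffunE; exact: IH.
Qed.

Lemma subst_literal_id x t Q : literal Q -> ~~ free x Q -> subst x t Q = Q.
Proof.
case: Q => //= [s u|p a] _; first by rewrite negb_or => /andP[? ?]; rewrite !subst_term_id.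
move=> /existsPn xa; congr Atom; apply/ffunP => i; rewrite ffunE; exact: subst_term_id.
Qed.

Lemma literal_subst x t Q : literal (subst x t Q) = literal Q.
Proof. by case: Q. Qed.

End Terms.

(** * The measure of a group of literals *)

Lemma leq_count_uniq (p : pred nat) (s s' : seq nat) :
  uniq s' -> (forall y, p y -> y \in s' -> y \in s) -> count p s' <= count p s.
Proof.
move=> us' ss'; rewrite -!size_filter; apply: uniq_leq_size; first exact: filter_uniq.
by move=> y; rewrite !mem_filter => /andP[py ys']; rewrite py ss'.
Qed.

Lemma ltn_count_uniq (p : pred nat) (s s' : seq nat) x :
  uniq s' -> (forall y, p y -> y \in s' -> y \in s) ->
  p x -> x \in s -> x \notin s' -> count p s' < count p s.
Proof.
move=> us' ss' px xs xs'.
have /leq_trans -> // : count p s' < count p (x :: s') by rewrite /= px.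
apply: leq_count_uniq; first by rewrite /= xs'.
by move=> y py; rewrite inE => /orP[/eqP ->|/ss'->].
Qed.

Lemma digits_bound (f : nat -> nat) B n :
  (forall d, f d < B) -> \sum_(d < n) f d * B ^ d < B ^ n.
Proof.
move=> fB; elim: n => [|n IH]; first by rewrite big_ord0.
rewrite big_ord_recr /= expnS.
apply: leq_trans (_ : (f n).+1 * B ^ n <= _); last by rewrite leq_mul.
by rewrite mulSn -addSn leq_add.
Qed.

(** Numerals in base [B] are decided by their most significant changing digit: the digits of [f]
    below [e] contribute less than [B ^ e] in total. *)
Lemma digits_lt (f g : nat -> nat) B n e :
  (forall d, f d < B) -> e < n -> f e < g e -> (forall d, e < d -> f d <= g d) ->
  \sum_(d < n) f d * B ^ d < \sum_(d < n) g d * B ^ d.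
Proof.
move=> fB + fg le; elim: n => // n IH; rewrite ltnS leq_eqVlt !big_ord_recr /=.
case/orP=> [/eqP <-|en].
  apply: leq_trans (_ : (f e).+1 * B ^ e <= _).
    by rewrite mulSn -addSn leq_add // digits_bound.
  by apply: leq_trans (leq_addl _ _); rewrite leq_mul.
by rewrite -addSn leq_add ?IH // leq_mul2r le ?orbT.
Qed.

Section Lists.
Variable L : language.
Implicit Types (t s : term L) (Q : query L) (x y z : nat) (l : seq (query L)).

Definition fvars l := flatten (map (@lvars L) l).
Definition lweight l := sumn (map (@lsize L) l).

Definition nonvar_eq y Q : bool :=
  if Q is Eq (Var z) (App _ _) then z == y else false.
Definition lhs_eq y Q : bool := if Q is Eq (Var z) _ then z == y else false.

(** Two tests [h] are used. Turning around an equation between variables cannot make a variable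
    unsolved for [nonvar_eq]; it can for [lhs_eq], which is why the variables unsolved for [lhs_eq]
    are counted by depth. *)
Definition unsolved (h : nat -> query L -> bool) l :=
  [seq y <- undup (fvars l) | ~~ ((count_mem y (fvars l) == 1) && has (h y) l)].

(* [pre] lists the bound variables in scope, the innermost one first; free
   variables have depth 0. *)
Definition depth (pre : seq nat) y := size pre - index y pre.

(* The left-hand side of an equation is counted once more, so that turning
   [z = x] around with [x] more deeply bound decreases the sum. *)
Definition low pre d Q : nat :=
  count (fun y => depth pre y < d) (lvars Q) +
  (if Q is Eq (Var z) _ then depth pre z < d else false).

Definition lows pre d l := sumn (map (low pre d) l).

(** A lexicographic pair packed into one number: [lows] never exceeds the weight, so the factor
    [(lweight l).+1] gives the count of unsolved variables precedence. *)
Definition digit pre l d :=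
  count (fun y => d <= depth pre y) (unsolved lhs_eq l) * (lweight l).+1 + lows pre d l.

(* Decreases when an atom is moved behind an equation. *)
Fixpoint inversions l :=
  if l is Q :: l' then is_atom Q * count (@is_eq L) l' + inversions l' else 0.

(* [n] is the number of quantifiers below the group, so that component 0
   vanishes on groups without quantifiers. Component 3 encodes the digits at the
   depths [d], the innermost depth being the most significant, as one number. *)
Definition measure j pre n l :=
  match j with
  | 0 => n * lweight l
  | 1 => size (unsolved nonvar_eq l)
  | 2 => lweight l
  | 3 => \sum_(d < (size pre).+1) digit pre l d * ((lweight l).+1 ^ 2) ^ d
  | _ => inversions l
  end.

Definition measure_dec pre n l' l := exists i, [/\ i < 5,
  measure i pre n l' < measure i pre n l &
  forall j, j < i -> measure j pre n l' <= measure j pre n l].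

Lemma fvars_cat l l' : fvars (l ++ l') = fvars l ++ fvars l'.
Proof. by rewrite /fvars map_cat flatten_cat. Qed.

Lemma lweight_cat l l' : lweight (l ++ l') = lweight l + lweight l'.
Proof. by rewrite /lweight map_cat sumn_cat. Qed.

Lemma lows_cat pre d l l' : lows pre d (l ++ l') = lows pre d l + lows pre d l'.
Proof. by rewrite /lows map_cat sumn_cat. Qed.

Lemma fvars_cons Q l : fvars (Q :: l) = lvars Q ++ fvars l.
Proof. by []. Qed.

Lemma unsolved_uniq h l : uniq (unsolved h l).
Proof. exact/filter_uniq/undup_uniq. Qed.

Lemma mem_unsolved h l y : (y \in unsolved h l) =
  (0 < count_mem y (fvars l)) && ~~ ((count_mem y (fvars l) == 1) && has (h y) l).
Proof. by rewrite mem_filter mem_undup andbC -has_pred1 has_count. Qed.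

Lemma count_fvars_leq (p : pred nat) l : count p (fvars l) <= lweight l.
Proof.
rewrite /fvars /lweight; elim: l => //= Q l IH; rewrite count_cat leq_add //.
case: Q => //= [s t|q a]; first by rewrite count_cat; have := count_tvars_leq p s; have := count_tvars_leq p t; lia.
rewrite sumn_flatten_map; apply: leqW; apply: leq_sumn_map => i.
exact: count_tvars_leq.
Qed.

Lemma low_leq pre d Q : low pre d Q <= lsize Q.
Proof.
rewrite /low; have := count_fvars_leq (fun y => depth pre y < d) [:: Q].
rewrite /fvars /lweight /= cats0 addn0; case: Q => //= [s t|p a]; last by lia.
rewrite count_cat; have := count_tvars_leq (fun y => depth pre y < d) s.
have := count_tvars_leq (fun y => depth pre y < d) t.
by case: s => [z|f a]; [rewrite /=|]; lia.
Qed.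

Lemma lows_leq pre d l : lows pre d l <= lweight l.
Proof. by apply: leq_sumn_map => Q; apply: low_leq. Qed.

(** With weight [w], both parts of the digit are at most [w], so it is at most [w * (w + 1) + w],
    one less than the base used in component 3. *)
Lemma digit_bound pre l d : digit pre l d < (lweight l).+1 ^ 2.
Proof.
have A : count (fun y => d <= depth pre y) (unsolved lhs_eq l) <= lweight l.
  apply: leq_trans (count_fvars_leq predT l); apply: leq_trans (count_size _ _) _.
  by rewrite size_filter; apply: leq_trans (count_size _ _) _; rewrite count_predT size_undup.
rewrite /digit; have := lows_leq pre d l; have := leq_mul A (leqnn (lweight l).+1); nia.
Qed.

Lemma measure3_lt pre n l l' e : lweight l' = lweight l -> e <= size pre ->
  digit pre l' e < digit pre l e ->
  (forall d, e < d -> digit pre l' d <= digit pre l d) ->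
  measure 3 pre n l' < measure 3 pre n l.
Proof.
move=> lw ep lte led /=; rewrite lw.
apply: (@digits_lt (digit pre l') (digit pre l) _ _ e) => // d.
by rewrite -lw digit_bound.
Qed.

Lemma measure3_le pre n l l' : lweight l' = lweight l ->
  (forall d, digit pre l' d <= digit pre l d) ->
  measure 3 pre n l' <= measure 3 pre n l.
Proof. by move=> lw le /=; rewrite lw; apply: leq_sum => d _; rewrite leq_mul2r le orbT. Qed.

(** A variable solved before occurs once, so afterwards it occurs at most once, and its equation, if
    inside [l], survives in [l']. The alternative of two occurrences in [l] contradicts being
    solved; it covers [x = t] with [x] in [t]. *)
Lemma unsolved_local h l1 l l' l2 y :
  count_mem y (fvars l') <= count_mem y (fvars l) ->
  (has (h y) l -> has (h y) l' \/ 1 < count_mem y (fvars l)) ->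
  y \in unsolved h (l1 ++ l' ++ l2) -> y \in unsolved h (l1 ++ l ++ l2).
Proof.
rewrite !mem_unsolved !fvars_cat !count_cat !has_cat => le hh /andP[gt0 /nandP un].
apply/andP; split; first by lia.
apply/negP => /andP[/eqP c1 hs].
have c1' : count_mem y (fvars l1) + (count_mem y (fvars l') + count_mem y (fvars l2)) = 1 by lia.
case: un => [|/negP []]; first by rewrite c1'.
case/or3P: hs => [h1|/hh [h2|c2]|h3]; last by rewrite h3 !orbT.
- by rewrite h1.
- by rewrite h2 orbT.
- lia.
Qed.

Lemma measure1_local pre n l1 l l' l2 :
  (forall y, count_mem y (fvars l') <= count_mem y (fvars l)) ->
  (forall y, has (nonvar_eq y) l -> has (nonvar_eq y) l' \/ 1 < count_mem y (fvars l)) ->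
  measure 1 pre n (l1 ++ l' ++ l2) <= measure 1 pre n (l1 ++ l ++ l2).
Proof.
move=> le hh; rewrite /measure -!(count_predT (unsolved _ _)).
apply: leq_count_uniq; first exact: unsolved_uniq.
by move=> y _; apply: unsolved_local; [apply: le|apply: hh].
Qed.

(** Handles all rules that lower the weight without adding occurrences of variables: decomposition,
    failure, [x = x], turning [f(..) = x] around and deleting [True]. *)
Lemma measure_dec_local pre n l1 l l' l2 :
  (forall y, count_mem y (fvars l') <= count_mem y (fvars l)) ->
  (forall y, has (nonvar_eq y) l -> has (nonvar_eq y) l' \/ 1 < count_mem y (fvars l)) ->
  lweight l' < lweight l -> measure_dec pre n (l1 ++ l' ++ l2) (l1 ++ l ++ l2).
Proof.
move=> le hh lt.
have W : lweight (l1 ++ l' ++ l2) < lweight (l1 ++ l ++ l2) by rewrite !lweight_cat; lia.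
exists 2; split=> //; case=> [|[|//]] _; last exact: measure1_local.
by rewrite /= leq_mul2l (ltnW W) orbT.
Qed.

Lemma inversions_cat l l' :
  inversions (l ++ l') =
  inversions l + count (@is_atom L) l * count (@is_eq L) l' + inversions l'.
Proof.
elim: l => [|Q l IH] /=; first by rewrite mul0n.
by rewrite IH count_cat mulnDl mulnDr; lia.
Qed.

(** The first four components do not depend on the order of the literals, so the number of
    inversions decides. *)
Lemma measure_dec_move_atom pre n l1 l2 A s t : is_atom A ->
  measure_dec pre n (l1 ++ [:: Eq s t; A] ++ l2) (l1 ++ [:: A; Eq s t] ++ l2).
Proof.
move=> atA.
have W : lweight (l1 ++ [:: Eq s t; A] ++ l2) = lweight (l1 ++ [:: A; Eq s t] ++ l2).
  by rewrite !lweight_cat /lweight /=; lia.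
have C y : count_mem y (fvars [:: Eq s t; A]) <= count_mem y (fvars [:: A; Eq s t]).
  by rewrite !fvars_cons !count_cat; lia.
exists 4; split=> //.
  rewrite /measure !inversions_cat /= atA.
  by case: A {W C} atA => //= p a _; lia.
case=> [|[|[|[|//]]]] _.
- by rewrite /measure W.
- by apply: measure1_local => // y; rewrite /= orbCA => ->; left.
- by rewrite /measure W.
apply: measure3_le => // d; rewrite /digit W leq_add //.
  rewrite leq_mul2r; apply/orP; right.
  apply: leq_count_uniq; first exact: unsolved_uniq.
  move=> y _; apply: unsolved_local => //=.
  by rewrite orbCA => ->; left.
by rewrite !lows_cat /lows /=; lia.
Qed.

End Lists.

(** * Substitution, elimination and orientation decrease the measure of a group *)

Section Substitution.
Variable L : language.
Implicit Types (t s : term L) (Q : query L) (x y z : nat) (l : seq (query L)).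

Lemma count_fvars_subst x t l y : all (@literal L) l ->
  count_mem y (fvars (map (subst x t) l)) =
  (y != x) * count_mem y (fvars l) + count_mem x (fvars l) * count_mem y (tvars t).
Proof.
elim: l => [|Q l IH] /=; first by rewrite muln0.
case/andP=> lQ ll; rewrite !fvars_cons !count_cat count_subst_literal // IH //.
by rewrite mulnDr mulnDl addnACA.
Qed.

Lemma has_free_count x l : all (@literal L) l ->
  has (free x) l = (0 < count_mem x (fvars l)).
Proof.
elim: l => //= Q l IH /andP[lQ ll]; rewrite fvars_cons count_cat addn_gt0 -IH //.
by rewrite -has_count has_pred1 mem_lvars.
Qed.

(** What [nonvar_eq] and [lhs_eq] have in common, so that the effect of a substitution is analysed
    once for both. *)
Definition lhs_test (h : nat -> query L -> bool) := forall y Q, h y Q ->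
  (exists s, Q = Eq (Var y) s) /\ (forall x t, y != x -> h y (subst x t Q)).

Lemma lhs_test_nonvar_eq : lhs_test (@nonvar_eq L).
Proof.
move=> y [] //= [z|//] [//|f a] /eqP ->; split; first by exists (App a).
by move=> x t /negbTE yx; rewrite /= yx /=.
Qed.

Lemma lhs_test_lhs_eq : lhs_test (@lhs_eq L).
Proof.
move=> y [] //= [z|//] s /eqP ->; split; first by exists s.
by move=> x t /negbTE yx; rewrite /= yx /=.
Qed.

Lemma lhs_test_count h y l : lhs_test h -> has (h y) l -> 0 < count_mem y (fvars l).
Proof.
move=> hh; elim: l => //= Q l IH; rewrite fvars_cons count_cat => /orP[/hh[[s ->] _]|/IH].
  by rewrite /= eqxx.
by lia.
Qed.

Lemma lhs_test_subst h y x t l : lhs_test h -> y != x -> has (h y) l ->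
  has (h y) (map (subst x t) l).
Proof.
move=> hh yx; rewrite has_map; apply: sub_has => Q hQ /=.
by have [_ ->] := hh _ _ hQ.
Qed.

(** If [y] was solved, its only occurrence is a left-hand side in [P] or [S]; hence [y] is not in
    [t], the substitution creates no new occurrence of [y], and its equation persists. [E] stands
    for what becomes of [x = t]: the equation itself or [True]. *)
Lemma unsolved_subst h x t P S E y : lhs_test h -> all (@literal L) (P ++ S) ->
  count_mem y (lvars E) <= count_mem y (tvars t) -> y != x ->
  y \in unsolved h (map (subst x t) P ++ E :: map (subst x t) S) ->
  y \in unsolved h (P ++ Eq (Var x) t :: S).
Proof.
move=> hh; rewrite all_cat => /andP[lP lS] cE yx.
rewrite !mem_unsolved !fvars_cat !fvars_cons !count_cat !has_cat /=.
rewrite !count_fvars_subst // yx !mul1n [x == y]eq_sym (negbTE yx) add0n.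
have hP := @lhs_test_count h y P hh; have hS := @lhs_test_count h y S hh.
move: (count_mem y (fvars P)) (count_mem y (fvars S)) hP hS => cP cS hP hS.
move: (count_mem y (tvars t)) (count_mem y (lvars E)) cE => ct cE' cE.
move=> /andP[gt0 /negP un]; apply/andP; split.
  have [ct0|] := posnP ct; [|by lia].
  by move: cE gt0; rewrite ct0 leqn0 !muln0 => /eqP ->; lia.
apply/negP => /andP[/eqP c1 hs].
have hPS : has (h y) P || has (h y) S.
  case/or3P: hs => [->//|/hh[[s [E1 _]] _]|->]; last by rewrite orbT.
  by rewrite E1 eqxx in yx.
have cPS : 0 < cP + cS.
  by case/orP: hPS => [/hP|/hS]; lia.
apply: un; have -> : ct = 0 by lia.
apply/andP; split; first by rewrite !muln0; lia.
by case/orP: hPS => /(lhs_test_subst t hh yx) ->; rewrite ?orbT.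
Qed.

Lemma count_lvars_var x t y :
  count_mem y (lvars (Eq (Var x) t)) = (x == y) + count_mem y (tvars t).
Proof. by []. Qed.

Lemma mem_unsolved_count h l x : 1 < count_mem x (fvars l) -> x \in unsolved h l.
Proof. by rewrite mem_unsolved; case: (count_mem _ _) => [|[|]]. Qed.

(** If [x] occurs elsewhere, it was unsolved and now disappears, which lowers component 1 even
    though the weight may grow; component 0 is 0 as no quantifier lies below the matrix. Otherwise
    the substitution changes nothing and the weight drops. *)
Lemma measure_dec_eliminate pre x t P S : all (@literal L) (P ++ S) -> ~~ occ_term x t ->
  measure_dec pre 0 (map (subst x t) P ++ QTrue :: map (subst x t) S)
             (P ++ Eq (Var x) t :: S).
Proof.
move=> lPS xt; have := lPS; rewrite all_cat => /andP[lP lS].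
have ct : count_mem x (tvars t) = 0 by apply/count_memPn; rewrite mem_tvars.
have xL' : x \notin unsolved (@nonvar_eq L) (map (subst x t) P ++ QTrue :: map (subst x t) S).
  by rewrite mem_unsolved fvars_cat fvars_cons !count_cat !count_fvars_subst // eqxx ct !muln0.
have sub y : y \in unsolved (@nonvar_eq L) (map (subst x t) P ++ QTrue :: map (subst x t) S) ->
    y \in unsolved (@nonvar_eq L) (P ++ Eq (Var x) t :: S).
  move=> yL'; have yx : y != x by apply: contraNneq xL' => yx; rewrite -[X in X \in _]yx.
  exact: unsolved_subst lhs_test_nonvar_eq lPS _ yx yL'.
case: (boolP (has (free x) (P ++ S))) => [|nx].
  rewrite has_free_count // fvars_cat count_cat => cx; exists 1; split=> //.
    rewrite /measure -!(count_predT (unsolved _ _)).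
    apply: (@ltn_count_uniq _ _ _ x) => //; first exact: unsolved_uniq.
      by move=> y _; apply: sub.
    apply: mem_unsolved_count; rewrite fvars_cat count_cat fvars_cons count_cat count_lvars_var eqxx; lia.
  by case.
exists 2; split=> //; last case=> [|[|//]] // _.
  have idl l : all (@literal L) l -> ~~ has (free x) l -> map (subst x t) l = l.
    elim: l => //= Q l IH /andP[lQ ll]; rewrite negb_or => /andP[xQ xl].
    by rewrite subst_literal_id // IH.
  move: nx; rewrite has_cat negb_or => /andP[xP xS].
  rewrite /= !idl // !lweight_cat /lweight /= ; have := tsize_gt0 t; lia.
rewrite /measure -!(count_predT (unsolved _ _)).
by apply: leq_count_uniq => [|y _ /sub //]; apply: unsolved_uniq.
Qed.

Lemma depth_leq pre x : depth pre x <= size pre.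
Proof. exact: leq_subr. Qed.

(** The second summand records a strict drop: each occurrence of [x] at depth below [d] is replaced
    by one of [w] at depth at least [d]. *)
Lemma low_rename pre d x w Q : literal Q ->
  (depth pre w < d -> depth pre x < d) ->
  low pre d (subst x (Var w) Q) + (~~ (depth pre w < d) && (depth pre x < d) && (x \in lvars Q))
    <= low pre d Q.
Proof.
move=> lQ wx; rewrite /low lvars_rename // count_map.
set p := fun y => _; set p' := preim _ _.
have sub y : p' y -> p y by rewrite /p' /p /rename /=; case: eqP => [->|].
have H1 : (if subst x (Var w) Q is Eq (Var z) _ then depth pre z < d else false) <=
          (if Q is Eq (Var z) _ then depth pre z < d else false).
  case: Q lQ => //= -[z|f a] s _ //=.
  by case: eqP => [->|_] //; case: (depth pre w < d) wx => // ->.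
have H2 : count p' (lvars Q) + (~~ (depth pre w < d) && (depth pre x < d) && (x \in lvars Q))
    <= count p (lvars Q).
  case: (boolP (_ && _)) => [/andP[/andP[wd xd]]|_]; last by rewrite addn0 sub_count.
  elim: (lvars Q) => //= y r IH; rewrite inE => /orP[/eqP <-|/IH le].
    rewrite {1}/p' /p /= /rename eqxx xd (negbTE wd) add0n addn1 ltnS.
    exact: sub_count.
  rewrite -addnA; apply: leq_add le; have := sub y; rewrite /p' /=.
  by case: (p (rename x w y)) => // ->.
by rewrite addnAC; apply: leq_add.
Qed.

Lemma lows_rename pre d x w l : all (@literal L) l ->
  (depth pre w < d -> depth pre x < d) ->
  lows pre d (map (subst x (Var w)) l) +
    (~~ (depth pre w < d) && (depth pre x < d) && has (free x) l) <= lows pre d l.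
Proof.
move=> + wx; elim: l => [|Q l IH] /=; first by rewrite andbF.
case/andP=> lQ /IH; have := low_rename lQ wx; rewrite /lows /= mem_lvars //.
by case: (~~ _ && _) => /=; case: (free x Q) => /=; lia.
Qed.

Lemma lweight_rename x w l : lweight (map (subst x (@Var L w)) l) = lweight l.
Proof. by rewrite /lweight -map_comp; congr sumn; apply: eq_map => Q /=; rewrite lsize_rename. Qed.

(** After the step [x] occurs only on the left of its equation. If [t] is an application, [x] has
    become solved for [nonvar_eq] and component 1 drops; if [t] is a variable, the weight is
    unchanged and component 3 drops. *)
Lemma measure_dec_substitute pre x t P S : all (@literal L) (P ++ S) ->
  ~~ occ_term x t -> has (free x) (P ++ S) ->
  measure_dec pre 0 (map (subst x t) P ++ Eq (Var x) t :: map (subst x t) S)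
             (P ++ Eq (Var x) t :: S).
Proof.
move=> lPS xt xPS; have := lPS; rewrite all_cat => /andP[lP lS].
have ct : count_mem x (tvars t) = 0 by apply/count_memPn; rewrite mem_tvars.
set l' := _ ++ _ :: map _ _; set l := P ++ _ :: S.
have xL h : x \in unsolved h l.
  move: xPS; rewrite has_free_count // fvars_cat count_cat => cx.
  by apply: mem_unsolved_count; rewrite fvars_cat count_cat fvars_cons count_cat count_lvars_var eqxx; lia.
have cxL' : count_mem x (fvars l') = 1.
  by rewrite fvars_cat fvars_cons !count_cat !count_fvars_subst //= eqxx ct !muln0.
have sub h y : lhs_test h -> y \in unsolved h l' -> y \in unsolved h l.
  move=> hh; have [->|yx] := eqVneq y x; first by rewrite xL.
  by apply: unsolved_subst => //=; rewrite eq_sym (negbTE yx).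
have m1 : measure 1 pre 0 l' <= measure 1 pre 0 l.
  rewrite /measure -!(count_predT (unsolved _ _)).
  apply: leq_count_uniq; first exact: unsolved_uniq.
  by move=> y _; apply/sub/lhs_test_nonvar_eq.
case: t => [w|f a] in xt ct l' l xL cxL' sub m1 *; last first.
  exists 1; split=> //; last by case.
  rewrite /measure -!(count_predT (unsolved _ _)).
  apply: (@ltn_count_uniq _ _ _ x) => //; first exact: unsolved_uniq.
    by move=> y _; apply/sub/lhs_test_nonvar_eq.
  by rewrite mem_unsolved cxL' /= has_cat /= eqxx orbT.
have W : lweight l' = lweight l by rewrite !lweight_cat /lweight /= -!/(lweight _) !lweight_rename.
exists 3; split=> //; last first.
  by case=> [|[|[|//]]] _ //; rewrite /measure W.
have xL' : x \notin unsolved (@lhs_eq L) l'.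
  by rewrite mem_unsolved cxL' /= has_cat /= eqxx orbT.
have A d : count (fun y => d <= depth pre y) (unsolved (@lhs_eq L) l') <=
           count (fun y => d <= depth pre y) (unsolved (@lhs_eq L) l).
  apply: leq_count_uniq; first exact: unsolved_uniq.
  by move=> y _; apply/sub/lhs_test_lhs_eq.
have C d : (depth pre w < d -> depth pre x < d) ->
    lows pre d l' + (~~ (depth pre w < d) && (depth pre x < d)) <= lows pre d l.
  move=> wx; have := lows_rename lPS wx; rewrite xPS andbT.
  by rewrite map_cat !lows_cat /lows /=; lia.
have le d : (depth pre w < d -> depth pre x < d) -> digit pre l' d <= digit pre l d.
  move=> /C Cd; rewrite /digit W; apply: leq_add; first by rewrite leq_mul2r A orbT.
  by lia.
(* If [w] is bound no deeper than [x], the digit at the depth of [x] drops because [x] becomes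
   solved for [lhs_eq]. Otherwise the digit at the depth of [w] drops because less deeply bound
   occurrences of [x] turn into [w]. *)
have [wx|xw] := leqP (depth pre w) (depth pre x).
  apply: (@measure3_lt _ _ _ _ _ (depth pre x)) => //; first exact: depth_leq.
    have Ax : count (fun y => depth pre x <= depth pre y) (unsolved (@lhs_eq L) l') <
              count (fun y => depth pre x <= depth pre y) (unsolved (@lhs_eq L) l).
      apply: (@ltn_count_uniq _ _ _ x) => //; first exact: unsolved_uniq.
      by move=> y _; apply/sub/lhs_test_lhs_eq.
    have := lows_leq pre (depth pre x) l'; rewrite /digit W => lo.
    by apply: leq_trans (leq_addr _ _); apply: leq_trans (leq_mul Ax (leqnn _)); rewrite mulSn; lia.
  by move=> d xd; apply: le.
apply: (@measure3_lt _ _ _ _ _ (depth pre w)) => //; first exact: depth_leq.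
  have := C (depth pre w); rewrite ltnn xw /= => /(_ (fun=> isT)) Cd.
  by rewrite /digit W -addnS; apply: leq_add; [rewrite leq_mul2r A orbT|lia].
by move=> d wd; apply: le => _; apply: ltn_trans wd.
Qed.

Lemma measure_dec_orient_app pre n (f : fsym L) (a : {ffun 'I_(far f) -> term L}) x l1 l2 :
  measure_dec pre n (l1 ++ [:: Eq (Var x) (App a)] ++ l2) (l1 ++ [:: Eq (App a) (Var x)] ++ l2).
Proof.
apply: measure_dec_local => [y|y //|]; last by rewrite /lweight /=; lia.
by rewrite /fvars /= !cats0 count_cat /= addn0 addnC.
Qed.

(** Only [z] can become unsolved, and it is too shallow to count at the depth of [x] or deeper. At
    the depth of [x] the sum [lows] drops, since the doubly counted left-hand side is no longer the
    shallow [z]. *)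
Lemma measure_dec_orient_var pre n x z l1 l2 : depth pre z < depth pre x ->
  measure_dec pre n (l1 ++ [:: Eq (Var x) (Var z)] ++ l2)
             (l1 ++ [:: Eq (Var z) (@Var L x)] ++ l2).
Proof.
move=> zx; have W : lweight (l1 ++ [:: Eq (Var x) (Var z)] ++ l2) =
    lweight (l1 ++ [:: Eq (Var z) (@Var L x)] ++ l2).
  by rewrite !lweight_cat /lweight.
have C y : count_mem y (fvars [:: Eq (Var x) (Var z)]) <=
           count_mem y (fvars [:: Eq (Var z) (@Var L x)]).
  by rewrite /=; lia.
exists 3; split=> //; last first.
  case=> [|[|[|//]]] _; try by rewrite /measure W.
  exact: measure1_local.
have A d : depth pre x <= d ->
    count (fun y => d <= depth pre y)
      (unsolved (@lhs_eq L) (l1 ++ [:: Eq (Var x) (Var z)] ++ l2)) <=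
    count (fun y => d <= depth pre y)
      (unsolved (@lhs_eq L) (l1 ++ [:: Eq (Var z) (Var x)] ++ l2)).
  move=> xd; apply: leq_count_uniq; first exact: unsolved_uniq.
  move=> y dy; apply: unsolved_local; first exact: C.
  rewrite /= !orbF => /eqP zy.
  by rewrite -zy in dy; lia.
apply: (@measure3_lt _ _ _ _ _ (depth pre x)) => //; first exact: depth_leq.
  rewrite /digit W -addnS; apply: leq_add; first by rewrite leq_mul2r A // orbT.
  by rewrite !lows_cat /lows /low /= zx ltnn; lia.
move=> d xd; rewrite /digit W; apply: leq_add; first by rewrite leq_mul2r A ?orbT // ltnW.
by rewrite !lows_cat /lows /low /= xd (ltn_trans zx xd); lia.
Qed.

End Substitution.

(** * Termination *)

Section Queries.
Variable L : language.
Implicit Types (t s : term L) (P Q : query L) (x y z : nat) (l : seq (query L)).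

Fixpoint nquant Q : nat :=
  match Q with
  | And Q1 Q2 => nquant Q1 + nquant Q2
  | Ex _ Q1 => (nquant Q1).+1
  | _ => 0
  end.

(* The literals of the topmost group, up to the outermost quantifiers. *)
Fixpoint leaves Q : seq (query L) :=
  match Q with
  | And Q1 Q2 => leaves Q1 ++ leaves Q2
  | Ex _ _ => [::]
  | _ => [:: Q]
  end.

(* Number of quantifiers plus number of pairs of quantifiers neither of which is
   in the scope of the other. *)
Fixpoint unnested Q : nat :=
  match Q with
  | And Q1 Q2 => unnested Q1 + unnested Q2 + nquant Q1 * nquant Q2
  | Ex _ Q1 => (unnested Q1).+1
  | _ => 0
  end.

(* Sum of the measures of all groups except the topmost one. *)
Fixpoint below j pre Q : nat :=
  match Q with
  | And Q1 Q2 => below j pre Q1 + below j pre Q2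
  | Ex x Q1 => measure j (x :: pre) (nquant Q1) (leaves Q1) + below j (x :: pre) Q1
  | _ => 0
  end.

(* [l1] and [l2] are the leaves around [Q] in the group containing it, and [n] is
   the number of quantifiers below that group. *)
Definition group_dec pre (c : bool) Q Q' := forall l1 l2 n,
  nquant Q <= n -> (c \/ [/\ l1 = [::], l2 = [::] & n = nquant Q]) ->
  exists i, [/\ i < 5,
    measure i pre n (l1 ++ leaves Q' ++ l2) + below i pre Q' <
    measure i pre n (l1 ++ leaves Q ++ l2) + below i pre Q &
    forall j, j < i ->
    measure j pre n (l1 ++ leaves Q' ++ l2) + below j pre Q' <=
    measure j pre n (l1 ++ leaves Q ++ l2) + below j pre Q].

(** Stated so as to pass through contexts. [unnested] of a conjunction multiplies quantifier
    numbers, hence [nquant] must not grow; in the second case it must stay equal, since it enters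
    component 0 of the enclosing groups. *)
Definition progress pre c Q Q' :=
  nquant Q' <= nquant Q /\ unnested Q' < unnested Q \/
  [/\ nquant Q' = nquant Q, unnested Q' <= unnested Q & group_dec pre c Q Q'].

Lemma progress_andl pre c Q Q' P :
  progress pre true Q Q' -> progress pre c (And Q P) (And Q' P).
Proof.
case=> [[le lt]|[E le dec]]; [left|right]; rewrite /=.
  by have := leq_mul le (leqnn (nquant P)); lia.
split; [by rewrite E | by rewrite E; lia | move=> l1 l2 n /= len _].
have [||i [i5 lt led]] := dec l1 (leaves P ++ l2) n; [by lia | by left |].
by exists i; split=> // [|j /led]; rewrite -!catA !addnA ?ltn_add2r ?leq_add2r.
Qed.

Lemma progress_andr pre c Q Q' P :
  progress pre true Q Q' -> progress pre c (And P Q) (And P Q').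
Proof.
case=> [[le lt]|[E le dec]]; [left|right]; rewrite /=.
  by have := leq_mul (leqnn (nquant P)) le; lia.
split; [by rewrite E | by rewrite E; lia | move=> l1 l2 n /= len _].
have [||i [i5 lt led]] := dec (l1 ++ leaves P) l2 n; [by lia | by left |].
rewrite -!catA in lt led.
by exists i; split=> // [|j /led]; rewrite -!catA !(addnCA (measure _ _ _ _)) ?ltn_add2l ?leq_add2l.
Qed.

Lemma progress_ex pre c x Q Q' :
  progress (x :: pre) false Q Q' -> progress pre c (Ex x Q) (Ex x Q').
Proof.
case=> [[le lt]|[E le dec]]; [left|right] => //=.
split; [by rewrite E | by [] | move=> l1 l2 n /= len _].
have [//||i [i5 lt led]] := dec [::] [::] (nquant Q); first by right.
rewrite /= !cats0 in lt led.
by exists i; split=> // [|j /led]; rewrite -{1}E ?ltn_add2l ?leq_add2l // E.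
Qed.

Lemma progress_exs ys pre (c : bool) Q Q' : (c -> ys <> [::]) ->
  progress (rev ys ++ pre) false Q Q' -> progress pre c (exs ys Q) (exs ys Q').
Proof.
elim: ys pre c => [|y ys IH] pre c cys prog.
  by case: c cys prog => // /(_ isT).
by apply/progress_ex/IH => //; rewrite rev_cons cat_rcons in prog.
Qed.

Lemma conj_cons Q l : l <> [::] -> conj (Q :: l) = And Q (conj l).
Proof. by case: l. Qed.

Definition leaf Q : bool := if Q is (And _ _ | Ex _ _) then false else true.

Lemma conj_leaves l : all leaf l ->
  [/\ nquant (conj l) = 0, leaves (conj l) = (if l is [::] then [:: QTrue] else l),
      unnested (conj l) = 0 & forall j pre, below j pre (conj l) = 0].
Proof.
elim: l => // Q [|Q' l] IH; first by case: Q {IH}.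
case/andP=> lQ /IH [E1 E2 E3 E4]; rewrite conj_cons //.
move: (conj (Q' :: l)) E1 E2 E3 E4 => C E1 E2 E3 E4.
by case: Q lQ => //=; rewrite E1 E2 E3 => *; split=> // *; rewrite E4.
Qed.

Lemma all_leaf l : all (@literal L) l -> all leaf l.
Proof. by apply: sub_all; case. Qed.

Lemma progress_leaves pre (c : bool) l l' Q Q' :
  nquant Q = 0 -> nquant Q' = 0 -> leaves Q = l -> leaves Q' = l' ->
  unnested Q' = 0 ->
  (forall j, below j pre Q = 0) -> (forall j, below j pre Q' = 0) ->
  (c -> forall l1 l2 n, measure_dec pre n (l1 ++ l' ++ l2) (l1 ++ l ++ l2)) ->
  measure_dec pre 0 l' l -> progress pre c Q Q'.
Proof.
move=> n0 n0' ll ll' u0 b0 b0' dec1 dec0; right; split; rewrite ?n0 ?n0' ?u0 //.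
move=> l1 l2 n _ cond.
have [i [i5 lt le]] : measure_dec pre n (l1 ++ l' ++ l2) (l1 ++ l ++ l2).
  by case: cond => [/dec1 //|[-> -> ->]]; rewrite n0 /= !cats0.
by exists i; split=> // [|j /le]; rewrite ?b0 ?b0' !addn0 ll ll'.
Qed.

Lemma progress_conj pre (c : bool) l l' : all leaf l -> all leaf l' -> l <> [::] -> l' <> [::] ->
  (c -> forall l1 l2 n, measure_dec pre n (l1 ++ l' ++ l2) (l1 ++ l ++ l2)) ->
  measure_dec pre 0 l' l -> progress pre c (conj l) (conj l').
Proof.
move=> /conj_leaves [n0 f0 _ b0] /conj_leaves [n0' f0' u0' b0'] ln ln'.
apply: progress_leaves => //; [by rewrite f0; case: l ln {n0 f0 b0}|].
by rewrite f0'; case: l' ln' {n0' f0' b0' u0'}.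
Qed.

Lemma progress_leaf pre c l l' : all leaf l -> all leaf l' -> l <> [::] -> l' <> [::] ->
  (forall y, count_mem y (fvars l') <= count_mem y (fvars l)) ->
  (forall y, has (nonvar_eq y) l -> has (nonvar_eq y) l' \/ 1 < count_mem y (fvars l)) ->
  lweight l' < lweight l -> progress pre c (conj l) (conj l').
Proof.
move=> al al' ln ln' h1 h2 h3.
apply: progress_conj => // [_ l1 l2 n|]; first exact: measure_dec_local.
by have := @measure_dec_local _ pre 0 [::] l l' [::] h1 h2 h3; rewrite /= !cats0.
Qed.

Lemma below0_pre Q pre pre' : below 0 pre Q = below 0 pre' Q.
Proof.
elim: Q pre pre' => //= [Q1 IH1 Q2 IH2|v Q IH] pre pre'.
  by rewrite (IH1 _ pre') (IH2 _ pre').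
by rewrite (IH _ (v :: pre')).
Qed.

(** The data that renaming bound variables preserves and that decide a prenex step. Of the group
    components only component 0 is kept, which depends on no variable names and no depths. *)
Definition same_shape Q Q' := [/\ nquant Q' = nquant Q, unnested Q' = unnested Q,
  lweight (leaves Q') = lweight (leaves Q) &
  forall pre pre', below 0 pre Q' = below 0 pre' Q].

Lemma same_shape_subst x y Q : same_shape Q (subst x (Var y) Q).
Proof.
rewrite /same_shape; elim: Q => /= [||s t|p a|Q1 [n1 u1 w1 b1] Q2 [n2 u2 w2 b2]|z Q [n u w b]]; split=> //.
- by rewrite /lweight /= !tsize_rename.
- exact: (congr1 (addn^~ 0) (lsize_rename x y (Atom a))).
- by rewrite n1 n2.
- by rewrite n1 n2 u1 u2.
- by rewrite !lweight_cat w1 w2.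
- by move=> pre pre'; rewrite (b1 _ pre') (b2 _ pre').
- by case: ifP; rewrite ?n.
- by case: ifP; rewrite ?u.
by move=> pre pre'; case: ifP => _; [rewrite (below0_pre Q _ (z :: pre'))|rewrite n w (b _ (z :: pre'))].
Qed.

Lemma same_shape_ctx c Q Q' : ctx (@rename_rule L) c Q Q' -> same_shape Q Q'.
Proof.
elim=> {c Q Q'} [c _ _ [x y Q _]|c Q Q' P _ [n u w b]|c Q Q' P _ [n u w b]|c x Q Q' _ [n u w b]].
- have [n u w b] := same_shape_subst x y Q.
  by split=> //=; rewrite ?n ?u // => pre pre'; rewrite ?n w (b _ (x :: pre')).
- split=> /=; rewrite ?n ?u ?lweight_cat ?w // => pre pre'.
  by rewrite (b _ pre') (below0_pre P _ pre').
- split=> /=; rewrite ?n ?u ?lweight_cat ?w // => pre pre'.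
  by rewrite (b _ pre') (below0_pre P _ pre').
by split=> //=; rewrite ?n ?u // => pre pre'; rewrite ?n w (b _ (x :: pre')).
Qed.

Lemma same_shape_variant Q Q' : variant Q Q' -> same_shape Q Q'.
Proof.
elim=> {Q Q'} [Q Q'|Q|Q Q' _ [n u w b]|Q1 Q2 Q3 _ [n u w b] _ [n' u' w' b']].
- exact: same_shape_ctx.
- by split=> // pre pre'; apply: below0_pre.
- by split=> // pre pre'; rewrite (b _ pre).
by split; [rewrite n' | rewrite u' | rewrite w' | move=> pre pre'; rewrite (b' _ pre')].
Qed.

Lemma nquant_exs ys Q : nquant (exs ys Q) = size ys + nquant Q.
Proof. by elim: ys => //= y ys ->. Qed.

Lemma unnested_exs ys Q : unnested (exs ys Q) = size ys + unnested Q.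
Proof. by elim: ys => //= y ys ->. Qed.

(** Groups between consecutive quantifiers of the prefix are empty, so only the group under the
    innermost one contributes. *)
Lemma below0_exs ys pre Q : ys <> [::] ->
  leaves (exs ys Q) = [::] /\
  below 0 pre (exs ys Q) = nquant Q * lweight (leaves Q) + below 0 pre Q.
Proof.
case: ys => // y ys _; split=> //; elim: ys y pre => [|y' ys IH] y pre.
  by rewrite /= (below0_pre Q _ pre).
transitivity (below 0 (y :: pre) (exs (y' :: ys) Q)); first by rewrite /= muln0.
by rewrite IH (below0_pre Q _ pre).
Qed.

Lemma below_nquant0 Q j pre : nquant Q = 0 -> below j pre Q = 0.
Proof.
elim: Q => //= Q1 IH1 Q2 IH2 /eqP; rewrite addn_eq0 => /andP[/eqP ? /eqP ?].
by rewrite IH1 ?IH2.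
Qed.

Lemma lweight_leaves_gt0 Q : nquant Q = 0 -> 0 < lweight (leaves Q).
Proof.
elim: Q => //= [s t|Q1 IH1 Q2 _ /eqP].
  by rewrite /lweight /= addn0 addn_gt0 tsize_gt0 orbT.
by rewrite addn_eq0 lweight_cat => /andP[/eqP/IH1 ? _]; rewrite addn_gt0; apply/orP; left.
Qed.

End Queries.

(** * Every rule makes progress, and the lexicographic order is well-founded *)

Section Termination.
Variable L : language.
Implicit Types (t s : term L) (P Q : query L) (x y z : nat) (l : seq (query L)).

Lemma progress_false pre c s t :
  (forall y, nonvar_eq y (Eq s t) -> 1 < count_mem y (fvars [:: Eq s t])) ->
  progress pre c (Eq s t) QFalse.
Proof.
move=> h; apply: (@progress_leaf _ pre c [:: Eq s t] [:: QFalse]) => //.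
  by move=> y; rewrite has_seq1 => /h; right.
by rewrite /lweight /=; have := tsize_gt0 s; have := tsize_gt0 t; lia.
Qed.

Lemma progress_decompose pre c (f : fsym L) (s t : {ffun 'I_(far f) -> term L}) :
  progress pre c (Eq (App s) (App t))
    (conj [seq Eq (s i) (t i) | i <- enum 'I_(far f)]).
Proof.
set l := [seq _ | i <- _].
(* For a constant [f] the list is empty, and its conjunction [QTrue] is still one leaf. *)
pose l' := if l is [::] then [:: QTrue] else l.
have -> : conj l = conj l' by rewrite /l'; case: (l).
have al : all (@leaf L) l by rewrite all_map; apply/allP.
apply: (@progress_leaf _ pre c [:: Eq (App s) (App t)] l') => //.
- by rewrite /l'; case: (l) al.
- by rewrite /l'; case: (l).
- move=> y; have -> : fvars l' = fvars l by rewrite /l'; case: (l).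
  rewrite /fvars /= cats0 count_cat /l; elim: (enum _) => //= i r IH.
  by rewrite !count_cat; lia.
- have le : lweight l' <= (lweight l).+1 by rewrite /l'; case: (l).
  apply: leq_ltn_trans le _; rewrite /lweight /= addn0.
  have -> : sumn (map (@lsize L) l) = 2 * sumn [seq tsize (s i) | i <- enum 'I_(far f)] +
      sumn [seq tsize (t i) | i <- enum 'I_(far f)].
    by rewrite /l; elim: (enum _) => //= i r ->; lia.
  have arith u v : (2 * u + v).+1 < 2 * (2 + u) + (2 + v) by lia.
  exact: arith.
Qed.

Lemma progress_delete_truel pre c Q : progress pre c (And QTrue Q) Q.
Proof.
right; split=> //=; first by rewrite mul0n addn0.
move=> l1 l2 n _ _.
have [||//|i [i5 lt le]] := @measure_dec_local L pre n l1 [:: QTrue] [::] (leaves Q ++ l2) => //.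
by exists i; split=> // [|j /le]; rewrite /= add0n ?ltn_add2r ?leq_add2r.
Qed.

Lemma progress_delete_truer pre c Q : progress pre c (And Q QTrue) Q.
Proof.
right; split=> //=; [by rewrite addn0|by rewrite muln0 !addn0|].
move=> l1 l2 n _ _.
have [||//|i [i5 lt le]] := @measure_dec_local L pre n (l1 ++ leaves Q) [:: QTrue] [::] l2 => //.
rewrite -!catA in lt le.
by exists i; split=> // [|j /le]; rewrite /= addn0 -!catA ?ltn_add2r ?leq_add2r.
Qed.

Lemma progress_move_atom pre c P s t : is_atom P ->
  progress pre c (And P (Eq s t)) (And (Eq s t) P).
Proof.
move=> aP; have lP : leaf P by case: P aP.
apply: (@progress_conj _ pre c [:: P; Eq s t] [:: Eq s t; P]) => //=; rewrite ?lP //.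
  by move=> _ l1 l2 n; apply: measure_dec_move_atom.
exact: (@measure_dec_move_atom L pre 0 [::] [::]).
Qed.

Lemma exs_cat ys ys' Q : exs (ys ++ ys') Q = exs ys (exs ys' Q).
Proof. by rewrite /exs foldr_cat. Qed.

(** If both operands contain quantifiers, some unnested pairs disappear. Otherwise the literals of
    the quantifier-free operand, of positive weight, move from a group with at least [n] quantifiers
    below it into one with strictly fewer, and component 0 drops. *)
Lemma progress_prenex pre c ys1 Q1 ys2 Q2 zs1 R1 zs2 R2 :
  ys1 <> [::] \/ ys2 <> [::] ->
  size zs1 = size ys1 -> @variant L (exs ys1 Q1) (exs zs1 R1) ->
  size zs2 = size ys2 -> variant (exs ys2 Q2) (exs zs2 R2) ->
  progress pre c (And (exs ys1 Q1) (exs ys2 Q2)) (exs zs1 (exs zs2 (And R1 R2))).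
Proof.
move=> ys0 s1 /same_shape_variant [n1 u1 w1 b1] s2 /same_shape_variant [n2 u2 w2 b2].
have N1 : nquant R1 = nquant Q1 by move: n1; rewrite !nquant_exs; lia.
have N2 : nquant R2 = nquant Q2 by move: n2; rewrite !nquant_exs; lia.
have U1 : unnested R1 = unnested Q1 by move: u1; rewrite !unnested_exs; lia.
have U2 : unnested R2 = unnested Q2 by move: u2; rewrite !unnested_exs; lia.
have ys0' : 0 < size ys1 + size ys2.
  by case: (ys1) (ys2) ys0 => [|? ?] [|? ?] //= [].
rewrite -exs_cat; have [nz|nz] := boolP (0 < (size ys1 + nquant Q1) * (size ys2 + nquant Q2)).
  left; rewrite /= !(nquant_exs, unnested_exs) /= size_cat N1 N2 U1 U2; nia.
right; split.
- by rewrite /= !nquant_exs /= size_cat; lia.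
- by rewrite /= !(nquant_exs, unnested_exs) /= size_cat N1 N2 U1 U2; nia.
move=> l1 l2 n; rewrite /= !nquant_exs => len _; exists 0; split=> //.
have zne : zs1 ++ zs2 <> [::] by case: (zs1) (zs2) s1 s2 => [|? ?] [|? ?] //= *; lia.
have [-> ->] := @below0_exs L (zs1 ++ zs2) pre (And R1 R2) zne.
rewrite /= !lweight_cat.
have {nz} [nz|nz] : size ys1 + nquant Q1 = 0 \/ size ys2 + nquant Q2 = 0 by nia.
  have [y1 y2] : ys1 = [::] /\ zs1 = [::] by split; apply: size0nil; lia.
  have zs0 : zs2 <> [::] by case: (zs2) s2 => //=; lia.
  have ys2n : ys2 <> [::] by case: (ys2) s2 ys0' => //=; lia.
  have [_ B] := @below0_exs L zs2 pre R2 zs0; have [-> _] := @below0_exs L ys2 pre Q2 ys2n.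
  rewrite y1 y2 /= in w1 b1 *; rewrite -(b1 pre) -(b2 pre) B w1.
  have -> : below 0 pre R1 = 0 by apply: below_nquant0; lia.
  have -> : lweight [::] = 0 by [].
  have w0 := @lweight_leaves_gt0 L Q1; nia.
have [y1 y2] : ys2 = [::] /\ zs2 = [::] by split; apply: size0nil; lia.
have zs0 : zs1 <> [::] by case: (zs1) s1 => //=; lia.
have ys1n : ys1 <> [::] by case: (ys1) s1 ys0' => //=; lia.
have [_ B] := @below0_exs L zs1 pre R1 zs0; have [-> _] := @below0_exs L ys1 pre Q1 ys1n.
rewrite y1 y2 /= in w2 b2 *; rewrite -(b2 pre) -(b1 pre) B w2.
have -> : below 0 pre R2 = 0 by apply: below_nquant0; lia.
have w0 := @lweight_leaves_gt0 L Q2; nia.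
Qed.

Lemma progress_rule pre c Q Q' : rule c Q Q' -> progress pre c Q Q'.
Proof.
case=> {Q Q'}.
- exact: progress_decompose.
- by move=> f g s t _; apply: progress_false.
- move=> x t tx xt; apply: progress_false => y /=; case: t tx xt => // f a _.
  rewrite -mem_tvars -has_pred1 has_count => c0 /eqP <-.
  by rewrite cats0 eqxx.
- by move=> x; apply: (@progress_leaf _ pre c [:: Eq (Var x) (Var x)] [:: QTrue]).
- move=> ys P x t S cys lPS tx xt _ hx; apply: progress_exs => //.
  have lPS' : all (@leaf L) (P ++ S) := all_leaf lPS.
  have lm l u : all (@literal L) l -> all (@leaf L) (map (subst x u) l).
    by move=> al; apply: all_leaf; rewrite all_map; apply: sub_all al => q /=; rewrite literal_subst.
  move: (lPS) (lPS'); rewrite !all_cat => /andP[lP lS] /andP[lP' lS'].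
  apply: progress_conj => //; rewrite ?all_cat /= ?lP' ?lS' ?lm //; try by case: (P).
  exact: measure_dec_substitute.
- move=> ys P x t S cys lPS tx xt _; apply: progress_exs => //.
  have lPS' : all (@leaf L) (P ++ S) := all_leaf lPS.
  have lm l u : all (@literal L) l -> all (@leaf L) (map (subst x u) l).
    by move=> al; apply: all_leaf; rewrite all_map; apply: sub_all al => q /=; rewrite literal_subst.
  move: (lPS) (lPS'); rewrite !all_cat => /andP[lP lS] /andP[lP' lS'].
  apply: progress_conj => //; rewrite ?all_cat /= ?lP' ?lS' ?lm //; try by case: (P).
  exact: measure_dec_eliminate.
- move=> ys P x t S cys lPS or; apply: progress_exs => //.
  have := all_leaf lPS; rewrite all_cat => /andP[lP' lS'].
  apply: progress_conj => //; rewrite ?all_cat /= ?lP' ?lS' //; try by case: (P).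
  case: t or => [z|f a] or; last exact: measure_dec_orient_app.
  case: or => [//|[z' [[<-] _ zys xys]]].
  (* Reversing [ys] puts its innermost binder first; [x] is found within that segment and [z] only
     beyond it, so [z] is less deep. *)
  apply: measure_dec_orient_var; rewrite /depth !index_cat !mem_rev (negbTE zys) xys.
  have : index x (rev ys) < size (rev ys) by rewrite index_mem mem_rev.
  have := index_size z pre; rewrite size_cat.
  have arith a b i j : i <= b -> j < a -> a + b - (a + i) < a + b - j by lia.
  exact: arith.
- by move=> y Q _; left=> /=; lia.
- by move=> *; apply: progress_prenex.
- by move=> *; apply: progress_move_atom.
- by move=> Q; apply: progress_delete_truel.
- by move=> Q; apply: progress_delete_truer.
Qed.

Lemma progress_ctx c Q Q' : ctx (@rule L) c Q Q' -> forall pre, progress pre c Q Q'.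
Proof.
elim=> {c Q Q'} [c Q Q' r|c Q Q' P _ IH|c Q Q' P _ IH|c x Q Q' _ IH] pre.
- exact: progress_rule.
- exact/progress_andl/IH.
- exact/progress_andr/IH.
exact/progress_ex/IH.
Qed.

Definition total_measure Q j : nat :=
  if j is j'.+1 then measure j' [::] (nquant Q) (leaves Q) + below j' [::] Q
  else unnested Q.

(** Components before the decreasing one may drop as well; with finitely many components the
    relation is still well-founded. *)
Definition lex_lt k (f g : nat -> nat) := exists i,
  [/\ i < k, f i < g i & forall j, j < i -> f j <= g j].

Lemma lex_lt_ctx Q Q' : ctx (@rule L) false Q Q' ->
  lex_lt 6 (total_measure Q') (total_measure Q).
Proof.
move=> /progress_ctx /(_ [::]) [[_ lt]|[E le dec]]; first by exists 0.
have [//||i [i5 lt led]] := dec [::] [::] (nquant Q); first by right.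
rewrite /= !cats0 in lt led.
exists i.+1; split; [exact: i5|by rewrite /= E|].
by case=> [_|j /led]; [exact: le|rewrite /= E].
Qed.

(** Nested induction: on the number of components, on a bound for component 0, and on the
    accessibility of the sequence shifted by one. *)
Lemma lex_lt_acc k f : Acc (lex_lt k) f.
Proof.
elim: k f => [|k IHk] f; first by constructor=> g [i []].
have [n] := ubnP (f 0); elim: n f => [f|n IHn f fn]; first by rewrite ltn0.
have [h Eh] : exists h, forall j, f j.+1 = h j by exists (fun j => f j.+1).
elim: (IHk h) f Eh fn => {}h _ IHh f Eh fn.
constructor=> g [[|i] [ik gf le]]; first by apply: IHn; apply: leq_trans gf _; rewrite -ltnS.
apply: (IHh (fun j => g j.+1)) => //; last by apply: leq_ltn_trans (le 0 isT) fn.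
by exists i; split=> // [|j ji]; rewrite -Eh //; apply: le.
Qed.

(** A step may rebracket conjunctions first, so the measure must not see brackets: leaves are
    concatenated and the pair counts regroup. *)
Lemma assoc_measure Q Q' : assoc Q Q' -> total_measure Q =1 total_measure Q'.
Proof.
suff H : assoc Q Q' -> [/\ nquant Q = nquant Q', leaves Q = leaves Q',
    unnested Q = unnested Q' & forall j pre, below j pre Q = below j pre Q'].
  by move=> /H[n l u b] [|j] //=; rewrite n l b.
elim=> {Q Q'} [Q Q'|//|Q Q' _ [n l u b]|Q1 Q2 Q3 _ [n l u b] _ [n' l' u' b']]; last 2 first.
- by split.
- by split=> *; rewrite ?n ?l ?u ?b.
elim=> {Q Q'} [c _ _ [Q1 Q2 Q3]|c Q Q' P _ [n l u b]|c Q Q' P _ [n l u b]|c x Q Q' _ [n l u b]].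
- split=> /= *; [by rewrite addnA|by rewrite catA|by lia|by rewrite addnA].
- by split=> /= *; rewrite ?n ?l ?u ?b.
- by split=> /= *; rewrite ?n ?l ?u ?b.
by split=> /= *; rewrite ?n ?l ?u ?b.
Qed.

Lemma alg_step_terminates (r : nat -> query L) :
  ~ (forall n, alg_step (r n) (r n.+1)).
Proof.
move=> step.
have dec n : lex_lt 6 (total_measure (r n.+1)) (total_measure (r n)).
  have [nf [[Q aQ /lex_lt_ctx [i [i6 lt le]]]|[_ F]]] := step n.
    have E := assoc_measure aQ.
    by exists i; split=> // [|j ji]; rewrite E //; apply: le.
  (* A jump to [QFalse] needs no decrease, since no step starts from there. *)
  by have [] := step n.+1.
have : forall f, Acc (lex_lt 6) f -> forall n, f <> total_measure (r n).
  by move=> f; elim=> {}f _ IH n E; apply: (IH (total_measure (r n.+1)) _ n.+1); rewrite ?E.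
by move=> /(_ _ (lex_lt_acc 6 (total_measure (r 0))) 0).
Qed.

End Termination.

(** * Soundness *)

Section Semantics.
Variable L : language.
Implicit Types (t s : term L) (P Q : query L) (x y z : nat) (l : seq (query L)).

Definition upd (J : preinterp L) (h : valuation J) x (d : J) : valuation J :=
  fun y => if y == x then d else h y.

Lemma eval_ext (J : preinterp L) (h h' : valuation J) t :
  (forall x, occ_term x t -> h x = h' x) -> eval h t = eval h' t.
Proof.
elim/term_ind_ffun: t => [x|f a IH] /= hh; first by apply: hh.
congr fint; apply/ffunP => i; rewrite !ffunE; apply: IH => x xi.
by apply: hh; apply/existsP; exists i.
Qed.

Lemma eval_subst (J : preinterp L) (h : valuation J) x t s :
  eval h (subst_term x t s) = eval (upd h x (eval h t)) s.
Proof.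
elim/term_ind_ffun: s => [z|f a IH] /=; first by rewrite /upd; case: ifP.
by congr fint; apply/ffunP => i; rewrite !ffunE IH.
Qed.

Lemma Sol_ext (J : preinterp L) Q (I : seq (interp J)) (h h' : valuation J) :
  (forall x, free x Q -> h x = h' x) -> Sol Q I h -> Sol Q I h'.
Proof.
elim: Q I h h' => //= [s t|p a|Q1 IH1 Q2 IH2|x Q IH] I h h' hh.
- by rewrite -(@eval_ext _ h h' s) -?(@eval_ext _ h h' t) // => x xo; apply: hh; rewrite xo ?orbT.
- case: I => // I0 [|//] /=; rewrite (_ : [ffun i => eval h (a i)] = [ffun i => eval h' (a i)]) //.
  apply/ffunP => i; rewrite !ffunE; apply: eval_ext => x xi; apply: hh.
  by apply/existsP; exists i.
- by case=> S1 S2; split; [apply: IH1 S1|apply: IH2 S2] => x xo; apply: hh; rewrite xo ?orbT.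
case=> d S; exists d; apply: IH S => y yo /=.
by case: eqP => // /eqP yx; apply: hh; rewrite yx.
Qed.

Lemma natoms_subst x t Q : natoms (subst x t Q) = natoms Q.
Proof. by elim: Q => //= [Q1 -> Q2 ->|y Q E] //; case: ifP. Qed.

Lemma Sol_subst_literal (J : preinterp L) Q (I : seq (interp J)) (h : valuation J) x t :
  literal Q -> Sol (subst x t Q) I h <-> Sol Q I (upd h x (eval h t)).
Proof.
case: Q => //= [s u|p a] _; first by rewrite !eval_subst.
case: I => // I0 [|//] /=.
rewrite (_ : [ffun i => eval h ([ffun i0 => subst_term x t (a i0)] i)] =
             [ffun i => eval (upd h x (eval h t)) (a i)]) //.
by apply/ffunP => i; rewrite !ffunE eval_subst.
Qed.

(** A pointwise form of [equivq], which composes as a congruence; equality of sets is recovered only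
    at the end. *)
Definition sem_eq Q Q' := natoms Q' = natoms Q /\
  forall J : preinterp L, model_FEA J -> forall I : seq (interp J),
  size I = natoms Q -> forall h, Sol Q I h <-> Sol Q' I h.

Lemma sem_eq_refl Q : sem_eq Q Q.
Proof. by []. Qed.

Lemma sem_eq_sym Q Q' : sem_eq Q Q' -> sem_eq Q' Q.
Proof.
by case=> n e; split=> // J FEA I sI h; apply: iff_sym; apply: e => //; rewrite sI n.
Qed.

Lemma sem_eq_trans Q1 Q2 Q3 : sem_eq Q1 Q2 -> sem_eq Q2 Q3 -> sem_eq Q1 Q3.
Proof.
case=> n e [n' e']; split=> [|J FEA I sI h]; first by rewrite n'.
by apply: iff_trans (e _ FEA _ sI h) _; apply: e' => //; rewrite sI n.
Qed.

Lemma size_take_natoms (T : Type) (I : seq T) n m : size I = n + m -> size (take n I) = n.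
Proof. by move=> sI; rewrite size_takel // sI leq_addr. Qed.

Lemma size_drop_natoms (T : Type) (I : seq T) n m : size I = n + m -> size (drop n I) = m.
Proof. by move=> sI; rewrite size_drop sI addKn. Qed.

Lemma sem_eq_and P P' Q Q' : sem_eq P P' -> sem_eq Q Q' -> sem_eq (And P Q) (And P' Q').
Proof.
case=> n e [n' e']; split=> /= [|J FEA I sI h]; first by rewrite n n'.
rewrite n.
have {}e := e J FEA _ (size_take_natoms sI) h.
have {}e' := e' J FEA _ (size_drop_natoms sI) h.
by split=> -[S1 S2]; split; [apply/e|apply/e'|apply/e|apply/e'].
Qed.

Lemma sem_eq_ex x Q Q' : sem_eq Q Q' -> sem_eq (Ex x Q) (Ex x Q').
Proof.
by case=> n e; split=> // J FEA I sI h; split=> -[d S]; exists d; apply/(e J FEA I sI).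
Qed.

Lemma sem_eq_ctx (R : bool -> query L -> query L -> Prop) c Q Q' :
  (forall c Q Q', R c Q Q' -> sem_eq Q Q') -> ctx R c Q Q' -> sem_eq Q Q'.
Proof.
move=> RS; elim=> {c Q Q'} [c Q Q' /RS //|c Q Q' P _ IH|c Q Q' P _ IH|c x Q Q' _ IH].
- exact/sem_eq_and/sem_eq_refl.
- exact/(sem_eq_and (sem_eq_refl P)).
exact: sem_eq_ex.
Qed.

Lemma sem_eq_assoc Q Q' : assoc Q Q' -> sem_eq Q Q'.
Proof.
elim=> {Q Q'} [Q Q'|//|Q Q' _|Q1 Q2 Q3 _ + _]; [|exact: sem_eq_sym|exact: sem_eq_trans].
apply: sem_eq_ctx => c _ _ [Q1 Q2 Q3]; split=> /= [|J FEA I sI h]; first by rewrite addnA.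
rewrite take_takel ?leq_addr // take_drop drop_drop.
have -> : natoms Q1 + natoms Q2 = natoms Q2 + natoms Q1 by rewrite addnC.
by split=> [[[? ?] ?]|[? [? ?]]].
Qed.

Lemma free_occ x Q : free x Q -> occ x Q.
Proof.
by elim: Q => //= [Q1 IH1 Q2 IH2 /orP[/IH1|/IH2] ->|y Q IH /andP[_ /IH ->]]; rewrite ?orbT.
Qed.

(** Since [y] does not occur in [Q] even as a bound variable, the replacement captures nothing. *)
Lemma Sol_rename (J : preinterp L) Q (I : seq (interp J)) (h : valuation J) x y :
  ~~ occ y Q -> Sol (subst x (Var y) Q) I h <-> Sol Q I (upd h x (h y)).
Proof.
elim: Q I h => [||s t|p a|Q1 IH1 Q2 IH2|z Q IH] I h //; try by move=> _; apply: Sol_subst_literal.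
  rewrite /= negb_or natoms_subst => /andP[/IH1 {}IH1 /IH2 {}IH2].
  by split=> -[? ?]; split; [apply/IH1|apply/IH2|apply/IH1|apply/IH2].
rewrite /= negb_or => /andP[yz yQ]; split=> -[d S]; exists d.
  move: S; case: eqP => [zx|/eqP zx].
    by apply: Sol_ext => v _; rewrite /upd -zx; case: (v == z).
  move/IH => /(_ yQ); apply: Sol_ext => v _; rewrite /upd (negbTE yz).
  by case: (eqVneq v x) => // ->; rewrite eq_sym (negbTE zx).
case: eqP => [zx|/eqP zx].
  by apply: Sol_ext S => v _; rewrite /upd -zx; case: (v == z).
apply/IH => //; apply: Sol_ext S => v _; rewrite /upd (negbTE yz).
by case: (eqVneq v x) => // ->; rewrite eq_sym (negbTE zx).
Qed.

Lemma sem_eq_variant Q Q' : variant Q Q' -> sem_eq Q Q'.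
Proof.
elim=> {Q Q'} [Q Q'|//|Q Q' _|Q1 Q2 Q3 _ + _]; [|exact: sem_eq_sym|exact: sem_eq_trans].
apply: sem_eq_ctx => {Q Q'} c _ _ [x y Q yQ]; split=> /= [|J FEA I sI h]; first by rewrite natoms_subst.
have yf v : free v Q -> (v == y) = false.
  by move=> fv; apply/negbTE; apply: contraNneq yQ => <-; apply: free_occ.
split=> -[d S]; exists d.
  apply/Sol_rename => //; apply: Sol_ext S => v /yf vy.
  by rewrite /upd eqxx vy.
move/Sol_rename: S => /(_ yQ); apply: Sol_ext => v /yf vy.
by rewrite /upd eqxx vy.
Qed.

Lemma natoms_exs ys Q : natoms (exs ys Q) = natoms Q.
Proof. by elim: ys. Qed.

(** A prefix amounts to one simultaneous change of the valuation on its variables, in which order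
    and repetitions no longer matter. *)
Lemma Sol_exs (J : preinterp L) ys Q (I : seq (interp J)) (h : valuation J) :
  Sol (exs ys Q) I h <-> exists2 h', (forall v, v \notin ys -> h' v = h v) & Sol Q I h'.
Proof.
elim: ys h => [|y ys IH] h /=.
  by split=> [S|[h' hh]]; [exists h|apply: Sol_ext => v _; apply: hh].
split=> [[d /IH[h' hh S]]|[h' hh S]].
  exists h' => // v; rewrite inE negb_or => /andP[vy vys].
  by rewrite hh // (negbTE vy).
exists (h' y); apply/IH; exists h' => // v vys.
by case: eqP => [->//|/eqP vy]; apply: hh; rewrite inE negb_or vy.
Qed.

Lemma sem_eq_exs ys Q Q' : sem_eq Q Q' -> sem_eq (exs ys Q) (exs ys Q').
Proof. by move=> e; elim: ys => //= y ys; apply: sem_eq_ex. Qed.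

Lemma natoms_conj l : natoms (conj l) = sumn (map (@natoms L) l).
Proof.
elim: l => // Q [|Q' l] IH; first by rewrite /= addn0.
by rewrite conj_cons // [natoms _]/= IH.
Qed.

Lemma Sol_conj_cons (J : preinterp L) Q l (I : seq (interp J)) (h : valuation J) :
  size I = natoms (conj (Q :: l)) ->
  Sol (conj (Q :: l)) I h <->
  Sol Q (take (natoms Q) I) h /\ Sol (conj l) (drop (natoms Q) I) h.
Proof.
case: l => [|Q' l] sI; last by rewrite conj_cons.
by rewrite /= in sI *; rewrite take_oversize ?sI //; split=> [|[]].
Qed.

Lemma Sol_conj_cat (J : preinterp L) l l' (I : seq (interp J)) (h : valuation J) :
  size I = natoms (conj (l ++ l')) ->
  Sol (conj (l ++ l')) I h <->
  Sol (conj l) (take (natoms (conj l)) I) h /\ Sol (conj l') (drop (natoms (conj l)) I) h.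
Proof.
elim: l I => [|Q l IH] I sI; first by rewrite /= drop0; split=> [|[]].
rewrite cat_cons in sI *; apply: iff_trans (Sol_conj_cons h sI) _.
have nE k : natoms (conj (Q :: k)) = natoms Q + natoms (conj k) by rewrite !natoms_conj.
have sd := size_drop_natoms (etrans sI (nE _)).
have sl : size (take (natoms (conj (Q :: l))) I) = natoms (conj (Q :: l)).
  by rewrite size_takel // sI !natoms_conj /= map_cat sumn_cat leq_add2l leq_addr.
have := Sol_conj_cons h sl; have := IH _ sd; rewrite nE.
rewrite take_takel ?leq_addr // [natoms Q + _]addnC -take_drop drop_drop => E' E.
by split=> [[S /E'[]]|[/E[] S S' S'']]; do ?split=> //; [apply/E|apply/E'].
Qed.

End Semantics.

(** * Soundness of the individual rules and of runs *)

Section Soundness.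
Variable L : language.
Implicit Types (t s : term L) (Q : query L) (x y z : nat) (l : seq (query L)).

Lemma natoms_conj_subst x t l : natoms (conj (map (subst x t) l)) = natoms (conj l).
Proof.
rewrite !natoms_conj -map_comp; congr sumn; apply: eq_map => Q /=.
exact: natoms_subst.
Qed.

Lemma Sol_conj_subst (J : preinterp L) x t l (I : seq (interp J)) (h : valuation J) :
  all (@literal L) l -> size I = natoms (conj l) ->
  Sol (conj (map (subst x t) l)) I h <-> Sol (conj l) I (upd h x (eval h t)).
Proof.
elim: l I => // Q l IH I /andP[lQ ll] sI.
have sI' : size I = natoms (conj (map (subst x t) (Q :: l))) by rewrite natoms_conj_subst.
apply: iff_trans (Sol_conj_cons _ sI') _; apply: iff_sym; apply: iff_trans (Sol_conj_cons _ sI) _.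
rewrite natoms_subst; have sd : size (drop (natoms Q) I) = natoms (conj l).
  by rewrite size_drop sI !natoms_conj /= addKn.
have E := IH _ ll sd; have E' := Sol_subst_literal (take (natoms Q) I) h x t lQ.
by split=> -[S S']; split; [apply/E'|apply/E|apply/E'|apply/E].
Qed.

Lemma Sol_conj_eq (J : preinterp L) l s t l' (I : seq (interp J)) (h : valuation J) :
  size I = natoms (conj l) + natoms (conj l') ->
  Sol (conj (l ++ Eq s t :: l')) I h <->
  [/\ Sol (conj l) (take (natoms (conj l)) I) h, eval h s = eval h t &
      Sol (conj l') (drop (natoms (conj l)) I) h].
Proof.
move=> sI; have sI' : size I = natoms (conj (l ++ Eq s t :: l')).
  by rewrite sI !natoms_conj map_cat sumn_cat.
have sd : size (drop (natoms (conj l)) I) = natoms (conj (Eq s t :: l')).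
  by rewrite (size_drop_natoms sI) !natoms_conj.
apply: iff_trans (Sol_conj_cat _ sI') _; have := Sol_conj_cons h sd; rewrite drop0 => E.
by split=> [[S /E[]]|[S S' S'']]; split=> //; apply/E.
Qed.

Lemma natoms_conj_eq l s t l' :
  natoms (conj (l ++ Eq s t :: l')) = natoms (conj l) + natoms (conj l').
Proof. by rewrite !natoms_conj map_cat sumn_cat. Qed.

Lemma natoms_conj_true l l' :
  natoms (conj (l ++ @QTrue L :: l')) = natoms (conj l) + natoms (conj l').
Proof. by rewrite !natoms_conj map_cat sumn_cat. Qed.

Lemma Sol_conj_true (J : preinterp L) l l' (I : seq (interp J)) (h : valuation J) :
  size I = natoms (conj l) + natoms (conj l') ->
  Sol (conj (l ++ QTrue :: l')) I h <->
  Sol (conj l) (take (natoms (conj l)) I) h /\ Sol (conj l') (drop (natoms (conj l)) I) h.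
Proof.
move=> sI; have sI' : size I = natoms (conj (l ++ QTrue :: l')).
  by rewrite natoms_conj_true.
have sd : size (drop (natoms (conj l)) I) = natoms (conj (QTrue :: l')).
  by rewrite (size_drop_natoms sI) !natoms_conj.
apply: iff_trans (Sol_conj_cat _ sI') _; have := Sol_conj_cons h sd; rewrite drop0 => E.
by split=> [[S /E[]]|[S S']]; split=> //; apply/E.
Qed.

Lemma upd_id (J : preinterp L) Q (I : seq (interp J)) (h : valuation J) x d :
  h x = d -> Sol Q I (upd h x d) <-> Sol Q I h.
Proof.
by move=> <-; split; apply: Sol_ext => v _; rewrite /upd; case: eqP => // ->.
Qed.

(** Where [x = t] holds, giving [x] the value of [t] does not change the valuation. *)
Lemma sem_eq_substitute P x t S : all (@literal L) (P ++ S) ->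
  sem_eq (conj (P ++ Eq (Var x) t :: S))
         (conj (map (subst x t) P ++ Eq (Var x) t :: map (subst x t) S)).
Proof.
rewrite all_cat => /andP[lP lS].
split=> [|J FEA I]; rewrite !natoms_conj_eq ?natoms_conj_subst // => sI h.
have E := Sol_conj_eq (Var x) t h sI.
have := @Sol_conj_eq J (map (subst x t) P) (Var x) t (map (subst x t) S) I h.
rewrite !natoms_conj_subst => /(_ sI) E'.
have EP := Sol_conj_subst x t h lP (size_take_natoms sI).
have ES := Sol_conj_subst x t h lS (size_drop_natoms sI).
split=> [/E[S1 ht S2]|/E'[S1 ht S2]]; [apply/E'|apply/E]; split=> //.
- by apply/EP/upd_id.
- by apply/ES/upd_id.
- by move/EP/upd_id: S1; apply.
- by move/ES/upd_id: S2; apply.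
Qed.

Lemma sem_eq_eliminate ys P x t S : all (@literal L) (P ++ S) ->
  ~~ occ_term x t -> x \in ys ->
  sem_eq (exs ys (conj (P ++ Eq (Var x) t :: S)))
         (exs ys (conj (map (subst x t) P ++ QTrue :: map (subst x t) S))).
Proof.
rewrite all_cat => /andP[lP lS] xt xys.
split=> [|J FEA I]; rewrite !natoms_exs natoms_conj_eq ?natoms_conj_true ?natoms_conj_subst // => sI h.
have E h' := Sol_conj_eq (Var x) t h' sI.
have := @Sol_conj_true J (map (subst x t) P) (map (subst x t) S) I.
rewrite !natoms_conj_subst => /(_ _ sI) E'.
have EP h' := Sol_conj_subst x t h' lP (size_take_natoms sI).
have ES h' := Sol_conj_subst x t h' lS (size_drop_natoms sI).
split=> /Sol_exs[h' hh]; move=> S'; apply/Sol_exs.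
  exists h' => //; case/E: S' => S1 ht S2; apply/E'.
  by split; [apply/EP/upd_id|apply/ES/upd_id].
(* The eliminated equation dictates the value of [x]. It may be changed because [x] is in the
   prefix, and [t] keeps its value because [x] does not occur in it. *)
exists (upd h' x (eval h' t)) => [v vys|].
  by rewrite /upd; case: eqP => [vx|_]; [rewrite vx xys in vys|apply: hh].
case/E': S' => /EP S1 /ES S2; apply/E; split=> //=.
rewrite {1}/upd eqxx; apply: eval_ext => v vt.
by rewrite /upd; case: eqP => // vx; rewrite vx (negbTE xt) in vt.
Qed.

Lemma sem_eq_orient P s t S :
  sem_eq (conj (P ++ Eq s t :: S)) (conj (P ++ Eq t s :: S)).
Proof.
split=> [|J FEA I]; rewrite !natoms_conj_eq // => sI h.
have E := Sol_conj_eq s t h sI; have E' := Sol_conj_eq t s h sI.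
by split=> [/E|/E'] [? ? ?]; [apply/E'|apply/E].
Qed.

Lemma sem_eq_decompose (f : fsym L) (s t : {ffun 'I_(far f) -> term L}) :
  sem_eq (Eq (App s) (App t)) (conj [seq Eq (s i) (t i) | i <- enum 'I_(far f)]).
Proof.
split=> [|J [inj _ _] I sI h].
  by rewrite natoms_conj -map_comp /=; elim: (enum _).
have nil r : natoms (conj [seq Eq (s i) (t i) | i <- r]) = 0.
  by rewrite natoms_conj; elim: r.
have C (r : seq 'I_(far f)) : Sol (conj [seq Eq (s i) (t i) | i <- r]) I h <->
    forall i, i \in r -> eval h (s i) = eval h (t i).
  elim: r => [|i r IH] //.
  have sI' : size I = natoms (conj [seq Eq (s i) (t i) | i <- i :: r]) by rewrite nil.
  apply: iff_trans (Sol_conj_cons h sI') _; rewrite [natoms _]/= drop0.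
  split=> [[E /IH Er] j|Er]; last first.
    by split; [apply: Er; rewrite inE eqxx|apply/IH => j jr; apply: Er; rewrite inE jr orbT].
  by rewrite inE => /orP[/eqP ->|/Er].
split=> [/= /inj E|/C E] /=; [apply/C => i _|apply/inj => i].
  by have := E i; rewrite !ffunE.
by rewrite !ffunE E // mem_enum.
Qed.

Lemma sem_eq_drop y Q : ~~ free y Q -> sem_eq (Ex y Q) Q.
Proof.
move=> yQ; split=> // J FEA I sI h; split=> [[d]|S]; last exists (h y).
  by apply: Sol_ext => v vQ; case: eqP => // vy; rewrite -vy vQ in yQ.
by apply: Sol_ext S => v vQ; case: eqP => // ->.
Qed.

Lemma sem_eq_prenex zs1 R1 zs2 R2 :
  (forall z, z \in zs2 -> ~~ @free L z R1) -> (forall z, z \in zs1 -> ~~ free z R2) ->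
  sem_eq (And (exs zs1 R1) (exs zs2 R2)) (exs zs1 (exs zs2 (And R1 R2))).
Proof.
move=> d1 d2; split=> [|J FEA I sI h]; first by rewrite !natoms_exs /= !natoms_exs.
rewrite /= natoms_exs; split.
  case=> /Sol_exs[h1 hh1 S1] /Sol_exs[h2 hh2 S2].
  (* The two witnesses are merged, first [h1] on [zs1], then [h2] on [zs2]; neither matrix has a
     free variable in the prefix of the other. *)
  pose h' : valuation J := fun v => if v \in zs1 then h1 v else h v.
  apply/Sol_exs; exists h' => [v /negbTE vz|]; first by rewrite /h' vz.
  apply/Sol_exs; exists (fun v => if v \in zs2 then h2 v else h' v) => [v /negbTE -> //|].
  split; [apply: Sol_ext S1|apply: Sol_ext S2] => v fv; rewrite /h'.
    have /negbTE -> : v \notin zs2 by apply: contraL fv => /d1.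
    by case: (boolP (v \in zs1)) => // /hh1.
  have /negbTE -> : v \notin zs1 by apply: contraL fv => /d2.
  by case: (boolP (v \in zs2)) => // /hh2.
case/Sol_exs=> h1 hh1 /Sol_exs[h2 hh2 [S1 S2]].
split; apply/Sol_exs.
  exists h1 => //; apply: Sol_ext S1 => v fv; apply: hh2.
  by apply: contraL fv => /d1.
exists (fun v => if v \in zs2 then h2 v else h v) => [v /negbTE -> //|].
apply: Sol_ext S2 => v fv; case: (boolP (v \in zs2)) => // /hh2 ->; apply: hh1.
by apply: contraL fv => /d2.
Qed.

Lemma sem_eq_rule c Q Q' : rule c Q Q' -> sem_eq Q Q'.
Proof.
case=> {Q Q'}.
- exact: sem_eq_decompose.
- by move=> f g s t fg; split=> // J [_ ne _] I sI h; split=> //= /ne; apply.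
- by move=> x t tx xt; split=> // J [_ _ oc] I sI h; split=> //= /oc; apply.
- by move=> x; split.
- by move=> ys P x t S _ lPS _ _ _ _; apply/sem_eq_exs/sem_eq_substitute.
- by move=> ys P x t S _ lPS _ xt xys; apply: sem_eq_eliminate.
- by move=> ys P x t S _ _ _; apply/sem_eq_exs/sem_eq_orient.
- exact: sem_eq_drop.
- move=> ys1 Q1 ys2 Q2 zs1 R1 zs2 R2 _ _ v1 _ v2 d1 d2.
  apply: sem_eq_trans (sem_eq_prenex d1 d2).
  by apply: sem_eq_and; apply: sem_eq_variant.
- case=> //= p a s t _; split=> // J _ I sI h /=.
  by rewrite drop0 take_oversize ?sI //; split=> -[].
- by move=> Q; split=> // J _ I sI h /=; rewrite drop0; split=> [[]|].
move=> Q; split=> /= [|J _ I]; rewrite addn0 // => sI h.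
by rewrite -sI take_size; split=> [[]|].
Qed.

Lemma Sol_has_false (J : preinterp L) Q (I : seq (interp J)) (h : valuation J) :
  has_false Q -> ~ Sol Q I h.
Proof.
elim: Q I h => //= [|Q1 IH1 Q2 IH2|x Q IH] I h; [by move=> _ []| |by move=> /IH F [d /F]].
by case/orP=> [/IH1 F [/F]|/IH2 F [_ /F]].
Qed.

Lemma sem_eq_equivq Q Q' : sem_eq Q Q' -> equivq Q' Q.
Proof.
case=> n e; split=> // J FEA I sI; apply/seteqP; split=> h S; apply/(e J FEA I) => //; by rewrite sI.
Qed.

(** Replacing a whole query by [QFalse] erases its atoms, so equivalence may fail merely because the
    numbers of atoms differ; the second alternative records this case. It is pulled back along the
    run, hence the induction from the first step. *)
Lemma run_sound Q Q' : run Q Q' ->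
  sem_eq Q Q' \/ [/\ Q' = QFalse, 0 < natoms Q & unsatisfiable Q].
Proof.
move=> /(@clos_rt_rt1n _ _ _ _) r; elim: r => {Q Q'} [Q|Q Q1 Q' [_ st] run IH]; first by left; apply: sem_eq_refl.
case: st => [[Q0 aQ rQ]|[hf E]].
  have e := sem_eq_trans (sem_eq_assoc aQ) (sem_eq_ctx sem_eq_rule rQ).
  case: IH => [e'|[E n u]]; first by left; apply: sem_eq_trans e'.
  case: e => ne e; right; split=> //; first by rewrite -ne.
  move=> J FEA I sI; apply/seteqP; split=> // h /(e J FEA I sI).
  by rewrite (u J FEA) ?sI.
(* No step leaves [QFalse], so the remaining run is trivial. *)
have -> : Q' = QFalse.
  by rewrite E in run; case: run => // R ? [].
have ns (J : preinterp L) (I : seq (interp J)) h : ~ Sol Q I h by apply: Sol_has_false.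
have [n0|n0] := posnP (natoms Q); [left|right].
  by split=> // J FEA I sI h; split=> // /ns.
by split=> // J FEA I sI; apply/seteqP; split=> // h /ns.
Qed.

End Soundness.

(** * Queries returned by the algorithm *)

Section Returned.
Variable L : language.
Implicit Types (t s : term L) (Q M : query L) (x y z : nat) (l : seq (query L)).

Lemma assoc_trans Q1 Q2 Q3 : assoc Q1 Q2 -> assoc Q2 Q3 -> assoc Q1 Q3.
Proof. exact: rst_trans. Qed.

Lemma assoc_map (f : query L -> query L) :
  (forall Q Q', ctx (@assoc_rule L) false Q Q' -> ctx (@assoc_rule L) false (f Q) (f Q')) ->
  forall Q Q', assoc Q Q' -> assoc (f Q) (f Q').
Proof.
move=> ff Q Q'; elim=> {Q Q'} [Q Q' /ff st|Q|Q Q' _|Q1 Q2 Q3 _ IH _]; last exact: assoc_trans.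
- exact: rst_step.
- exact: rst_refl.
exact: rst_sym.
Qed.

Lemma assoc_ctx_flag c c' Q Q' :
  ctx (@assoc_rule L) c Q Q' -> ctx (@assoc_rule L) c' Q Q'.
Proof.
move=> st; elim: st c' => {c Q Q'} [c _ _ [Q1 Q2 Q3]|c Q Q' P _ IH|c Q Q' P _ IH|c x Q Q' st _] c'.
- exact: ctx_here.
- exact/ctx_andl/IH.
- exact/ctx_andr/IH.
exact: ctx_ex.
Qed.

Lemma assoc_and Q1 Q1' Q2 Q2' :
  assoc Q1 Q1' -> assoc Q2 Q2' -> assoc (And Q1 Q2) (And Q1' Q2').
Proof.
move=> a1 a2; apply: (@assoc_trans _ (And Q1' Q2)).
  by apply: (assoc_map (f := fun Q => And Q Q2)) a1 => Q Q' st; apply/ctx_andl/assoc_ctx_flag/st.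
by apply: (assoc_map (f := And Q1')) a2 => Q Q' st; apply/ctx_andr/assoc_ctx_flag/st.
Qed.

Lemma assoc_exs ys Q Q' : assoc Q Q' -> assoc (exs ys Q) (exs ys Q').
Proof.
elim: ys => //= y ys IH /IH; apply: assoc_map => P P'; exact: ctx_ex.
Qed.

Lemma assoc_refl Q : assoc Q Q.
Proof. exact: rst_refl. Qed.

Lemma assoc_conj_cat l l' : l <> [::] -> l' <> [::] ->
  assoc (And (conj l) (conj l')) (conj (l ++ l')).
Proof.
elim: l => // Q [|Q' l] IH _ ln'; first by rewrite [conj (_ ++ _)]conj_cons //; apply: assoc_refl.
rewrite [conj (Q :: _)]conj_cons // [conj (_ ++ _)]conj_cons //.
apply: assoc_trans (assoc_and (assoc_refl Q) (IH _ ln')) => //.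
by apply: rst_step; apply: ctx_here; apply: AssocRule.
Qed.

Lemma leaves_neq0 Q : nquant Q = 0 -> leaves Q <> [::].
Proof. by move/lweight_leaves_gt0; case: (leaves Q). Qed.

Lemma assoc_leaves Q : nquant Q = 0 -> assoc Q (conj (leaves Q)).
Proof.
elim: Q => [||s t|p a|Q1 IH1 Q2 IH2|//]; try by move=> _; apply: assoc_refl.
move=> /= /eqP; rewrite addn_eq0 => /andP[/eqP n1 /eqP n2].
apply: assoc_trans (assoc_and (IH1 n1) (IH2 n2)) _.
by apply: assoc_conj_cat; apply: leaves_neq0.
Qed.

(** Brackets two neighbours together, which makes them a subquery to which [MoveAtom] can apply. *)
Lemma assoc_conj_pair l Q1 Q2 l' :
  assoc (conj (l ++ Q1 :: Q2 :: l')) (conj (l ++ And Q1 Q2 :: l')).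
Proof.
have H : assoc (conj (Q1 :: Q2 :: l')) (conj (And Q1 Q2 :: l')).
  case: l' => [|Q3 l']; first exact: assoc_refl.
  have st : ctx (@assoc_rule L) false (And (And Q1 Q2) (conj (Q3 :: l')))
      (And Q1 (And Q2 (conj (Q3 :: l')))) by apply: ctx_here; apply: AssocRule.
  by apply: rst_sym; apply: rst_step.
elim: l => [|Q l IH]; first exact: H.
rewrite !cat_cons; have nl P k : l ++ P :: k <> [::] by case: (l).
by rewrite !conj_cons //; apply: assoc_and IH; apply: assoc_refl.
Qed.

Lemma ctx_conj (R : bool -> query L -> query L -> Prop) l Q Q' l' c :
  (forall c, R c Q Q') -> ctx R c (conj (l ++ Q :: l')) (conj (l ++ Q' :: l')).
Proof.
move=> r; elim: l c => [|P l IH] c.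
  by case: l' => [|P l']; [apply: ctx_here|apply/ctx_andl/ctx_here].
rewrite !cat_cons; have nl P' k : l ++ P' :: k <> [::] by case: (l).
by rewrite !conj_cons //; apply: ctx_andr.
Qed.

Lemma ctx_exs (R : bool -> query L -> query L -> Prop) ys Q Q' :
  ctx R false Q Q' -> ctx R false (exs ys Q) (exs ys Q').
Proof. by elim: ys => //= y ys IH /IH; apply: ctx_ex. Qed.

Lemma mem_leq_sumn (s : seq nat) x : x \in s -> x <= sumn s.
Proof.
by elim: s => //= y s IH; rewrite inE => /orP[/eqP <-|/IH le]; lia.
Qed.

Lemma fresh_variable Q : exists z, ~~ occ z Q.
Proof.
suff [n nP] : exists n, forall z, n <= z -> ~~ occ z Q by exists n; apply: nP.
have lit Q' : literal Q' -> exists n, forall z, n <= z -> z \notin lvars Q'.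
  move=> _; exists (sumn (lvars Q')).+1 => z; apply: contraL => /mem_leq_sumn.
  by rewrite -leqNgt.
elim: Q => [||s t|p a|Q1 [n1 IH1] Q2 [n2 IH2]|x Q [n IH]].
- by exists 0.
- by exists 0.
- by have [n nP] := lit (Eq s t) isT; exists n => z /nP; rewrite mem_lvars.
- by have [n nP] := lit (Atom a) isT; exists n => z /nP; rewrite mem_lvars.
- exists (maxn n1 n2) => z; rewrite geq_max => /andP[/IH1 h1 /IH2 h2].
  by rewrite /= negb_or h1.
exists (maxn n x.+1) => z; rewrite geq_max => /andP[/IH h xz].
by rewrite /= negb_or h gtn_eqF.
Qed.

(** Steps independent of the flag survive when the query is placed under a conjunction or a
    quantifier. *)
Definition steps Q := exists Q', forall c, ctx (@rule L) c Q Q'.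

Lemma steps_andl Q Q' : steps Q -> steps (And Q Q').
Proof. by case=> Q1 st; exists (And Q1 Q') => c; apply: ctx_andl. Qed.

Lemma steps_andr Q Q' : steps Q -> steps (And Q' Q).
Proof. by case=> Q1 st; exists (And Q' Q1) => c; apply: ctx_andr. Qed.

Lemma variant_rename x z Q : ~~ occ z Q -> variant (Ex x Q) (Ex z (subst x (Var z) Q)).
Proof. by move=> zQ; apply: rst_step; apply: ctx_here; apply: RenameRule. Qed.

Lemma steps_prenexl x Q1 Q2 : steps (And (Ex x Q1) Q2).
Proof.
have [z] := fresh_variable (And Q1 Q2); rewrite /= negb_or => /andP[z1 z2].
exists (exs [:: z] (exs [::] (And (subst x (Var z) Q1) Q2))) => c; apply: ctx_here.
apply: (@Prenex L c [:: x] Q1 [::] Q2) => //=; first by left.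
- exact: variant_rename.
- exact: rst_refl.
by move=> v; rewrite inE => /eqP ->; apply: contra z2; apply: free_occ.
Qed.

Lemma steps_prenexr x Q1 Q2 : steps (And Q2 (Ex x Q1)).
Proof.
have [z] := fresh_variable (And Q1 Q2); rewrite /= negb_or => /andP[z1 z2].
exists (exs [::] (exs [:: z] (And Q2 (subst x (Var z) Q1)))) => c; apply: ctx_here.
apply: (@Prenex L c [::] Q2 [:: x] Q1) => //=; first by right.
- exact: rst_refl.
- exact: variant_rename.
by move=> v; rewrite inE => /eqP ->; apply: contra z2; apply: free_occ.
Qed.

Lemma steps_nested Q : 0 < nquant Q -> (exists x Q1, Q = Ex x Q1) \/ steps Q.
Proof.
elim: Q => //= [Q1 IH1 Q2 IH2|x Q _ _]; last by left; exists x, Q.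
rewrite addn_gt0 => /orP[/IH1|/IH2] [[x [Q ->]]|st]; right.
- exact: steps_prenexl.
- exact: steps_andl.
- exact: steps_prenexr.
exact: steps_andr.
Qed.

Definition reducible Q := exists Q', forall c, rule c Q Q'.

Lemma steps_leaf Q l Q1 l' : leaves Q = l ++ Q1 :: l' -> reducible Q1 -> steps Q.
Proof.
move=> E red; have : has (fun q => `[< reducible q >]) (leaves Q).
  by rewrite E has_cat /= (asboolT red) orbT.
have sr q : reducible q -> steps q by case=> q' r; exists q' => c; apply: ctx_here.
elim: Q {E} => //= [||s t|p a|P1 IH1 P2 IH2]; rewrite ?orbF; try by move/asboolP/sr.
by rewrite has_cat => /orP[/IH1|/IH2]; [apply: steps_andl|apply: steps_andr].
Qed.

Definition is_qtrue Q : bool := if Q is QTrue then true else false.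
Definition is_qfalse Q : bool := if Q is QFalse then true else false.

(** A leaf [True] that is not the whole query is an operand of some conjunction and can be deleted
    there. *)
Lemma steps_true Q : has is_qtrue (leaves Q) -> Q = QTrue \/ steps Q.
Proof.
elim: Q => //= [_|Q1 IH1 Q2 IH2]; first by left.
rewrite has_cat => /orP[/IH1|/IH2] [->|st]; right.
- by exists Q2 => c; apply: ctx_here; apply: DeleteTrueL.
- exact: steps_andl.
- by exists Q1 => c; apply: ctx_here; apply: DeleteTrueR.
exact: steps_andr.
Qed.

Lemma has_false_leaves Q : has is_qfalse (leaves Q) -> has_false Q.
Proof.
by elim: Q => //= Q1 IH1 Q2 IH2; rewrite has_cat => /orP[/IH1|/IH2] ->; rewrite ?orbT.
Qed.

Lemma has_false_exs ys Q : has_false (exs ys Q) = has_false Q.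
Proof. by elim: ys. Qed.

Lemma exs_split Q : exists ys M, Q = exs ys M /\ ~ exists x Q1, M = Ex x Q1.
Proof.
elim: Q => [||s t|p a|Q1 _ Q2 _|x Q [ys [M [-> nM]]]]; last by exists (x :: ys), M.
- by exists [::], QTrue; split=> // -[? []].
- by exists [::], QFalse; split=> // -[? []].
- by exists [::], (Eq s t); split=> // -[? []].
- by exists [::], (Atom a); split=> // -[? []].
by exists [::], (And Q1 Q2); split=> // -[? []].
Qed.

Lemma leaves_leaf Q : all (@leaf L) (leaves Q).
Proof. by elim: Q => //= Q1 IH1 Q2 IH2; rewrite all_cat IH1. Qed.

(** As for bubble sort, a list without an adjacent inversion is sorted. *)
Lemma split_eqs_atoms l : all (@literal L) l ->
  (forall P a s t S, is_atom a -> l = P ++ a :: Eq s t :: S -> False) ->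
  exists E As, [/\ l = E ++ As, all (@is_eq L) E & all (@is_atom L) As].
Proof.
elim: l => [|Q l IH]; first by exists [::], [::].
case/andP=> lQ /IH {}IH adj.
have [P a s t S aa El|E [As [El aE aA]]] := IH.
  by apply: (adj (Q :: P) a s t S) => //; rewrite El.
case: (boolP (is_eq Q)) => eQ; first by exists (Q :: E), As; rewrite El /= eQ.
have aQ : is_atom Q by move: lQ; rewrite /literal (negbTE eQ).
case: E El aE => [|[] //= s t E] El aE; first by exists [::], (Q :: As); rewrite El /= aQ.
by case: (adj [::] Q s t (E ++ As)) => //; rewrite El.
Qed.

Definition equations (E : seq (nat * term L)) := [seq Eq (Var e.1) e.2 | e <- E].

Lemma var_equations l : all (@is_eq L) l ->
  (forall P s t S, l = P ++ Eq s t :: S -> exists x, s = Var x) ->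
  exists E, l = equations E.
Proof.
elim: l => [|Q l IH]; first by exists [::].
case: Q => //= s t al lhs; have [x Ex] := lhs [::] s t l erefl.
have [//|P s' t' S El|E ->] := IH; first by apply: (lhs (Eq s t :: P) s' t' S); rewrite El.
by exists ((x, t) :: E); rewrite Ex.
Qed.

Lemma mem_fst_split (E : seq (nat * term L)) x : x \in map fst E ->
  exists E1 t E2, E = E1 ++ (x, t) :: E2.
Proof.
elim: E => //= -[y t] E IH; rewrite inE => /orP[/eqP ->|/IH[E1 [s [E2 ->]]]].
  by exists [::], t, E.
by exists ((y, t) :: E1), s, E2.
Qed.

Lemma uniq_fst (E : seq (nat * term L)) :
  (forall E1 x t E2, E = E1 ++ (x, t) :: E2 -> x \notin map fst (E1 ++ E2)) ->
  uniq (map fst E).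
Proof.
elim: E => //= -[x t] E IH h; apply/andP; split; first exact: (h [::] x t E).
apply: IH => E1 y s E2 EE; have := h ((x, t) :: E1) y s E2.
by rewrite EE /= inE negb_or => /(_ erefl) /andP[].
Qed.

Lemma has_free_equations x (E : seq (nat * term L)) :
  has (free x) (equations E) = (x \in map fst E) || has (occ_term x) (map snd E).
Proof.
elim: E => //= e E ->; rewrite inE.
by case: (x == e.1); case: (occ_term x e.2); rewrite /= ?orbT.
Qed.

Lemma returned_solved_form Q : returned Q -> solved_form Q.
Proof.
move=> ret; case: (pselect (Q = QFalse)) => [->|nF]; first by right; left.
have irr Q1 Q' : assoc Q Q1 -> ~ ctx (@rule L) false Q1 Q'.
  by move=> aQ st; apply: (ret Q'); split=> //; left; exists Q1.
have nf : ~~ has_false Q by apply/negP => hf; apply: (ret QFalse); split=> //; right.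
have [ys [M [EQ nM]]] := exs_split Q; rewrite {Q}EQ in ret nF irr nf *.
rewrite has_false_exs in nf.
have irrM : ~ steps M.
  by case=> M' st; apply: irr (assoc_refl _) _; apply: ctx_exs (st false).
have n0 : nquant M = 0.
  by case: (posnP (nquant M)) => // /steps_nested [].
have aM : assoc (exs ys M) (exs ys (conj (leaves M))) by apply/assoc_exs/assoc_leaves.
have bound P : assoc (exs ys M) (exs ys P) -> uniq ys /\ forall z, z \in ys -> free z P.
  move=> aP; suff H ys1 z ys2 : ys = ys1 ++ z :: ys2 -> (z \notin ys2) && free z P.
    split=> [|z /path.splitPr zys].
      elim: (ys) H => //= y r IH H; have /andP[-> _] := H [::] y r erefl.
      by apply: IH => ys1 z ys2 Er; apply: (H (y :: ys1)); rewrite Er.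
    by case: zys H => ys1 ys2 /(_ ys1 z ys2 erefl) /andP[].
  move=> E; apply/negPn/negP => nfz; apply: irr aP _; rewrite E exs_cat.
  apply: ctx_exs; apply: ctx_here; apply: DropQuantifier.
  apply: contra nfz; elim: (ys2) => //= y r IH /andP[zy /IH /andP[zr ->]].
  by rewrite inE negb_or zy zr.
(* A remaining [True] is the whole matrix, and then any quantifier before it would be vacuous, so
   the prefix is empty. *)
have [ht|nt] := boolP (has is_qtrue (leaves M)).
  left; have [EM|//] := steps_true ht; rewrite EM in bound *.
  case: (ys) bound => // y r /(_ QTrue (assoc_refl _)) [_ /(_ y)].
  by rewrite inE eqxx => /(_ isT).
have lit : all (@literal L) (leaves M).
  have nfl : ~~ has is_qfalse (leaves M) by apply: contra nf; apply: has_false_leaves.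
  elim: (leaves M) (leaves_leaf M) nt nfl => //= -[] //= *; by auto.
have red P q S : leaves M = P ++ q :: S -> ~ reducible q.
  by move=> E r; apply/irrM/steps_leaf/r/E.
right; right.
have [|E [As [El aE aA]]] := split_eqs_atoms lit.
  move=> P a s t S aa El; apply: irr (assoc_trans aM _) _.
    by apply: assoc_exs; rewrite El; apply: assoc_conj_pair.
  by apply: ctx_exs; apply: ctx_conj => c; apply: MoveAtom.
have litPS P q S : leaves M = P ++ q :: S -> all (@literal L) (P ++ S).
  by move=> E'; move: lit; rewrite E' !all_cat /= => /and3P[-> _ ->].
(* The rule acts on the whole query, hence with flag [false], under which an empty prefix is allowed
   as well. *)
have norule P : ~ rule false (exs ys (conj (leaves M))) P.
  by move=> r; apply: irr aM _; apply: ctx_here r.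
have lhs P s t S : leaves M = P ++ Eq s t :: S -> exists x, s = Var x.
  case: s => [x|f a] E'; first by exists x.
  case: t E' => [x|g b] E'.
    case: (norule (exs ys (conj (P ++ Eq (Var x) (App a) :: S)))).
    by rewrite E'; apply: Orient => //; [exact: litPS E'|left].
  case: (red _ _ _ E'); case: (pselect (f = g)) => [fg|fg].
    move: b E'; rewrite -fg => b _.
    by exists (conj [seq Eq (a i) (b i) | i <- enum 'I_(far f)]) => c; apply: Decompose.
  by exists QFalse => c; apply: Clash.
have [P s t S EE|E' EE] := var_equations aE.
  by apply: (lhs P s t (S ++ As)); rewrite El EE -catA.
(* The conclusions hold because [OccursCheck], [Eliminate], [Substitute] and [Orient], in this
   order, do not apply; [Reflexive] first excludes that [t] is [x]. *)
have solved P x t S : leaves M = P ++ Eq (Var x) t :: S ->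
    [/\ ~~ occ_term x t, x \notin ys, ~~ has (free x) (P ++ S) &
        forall z, t = Var z -> z \notin ys].
  move=> E1; have lPS := litPS _ _ _ E1.
  have tx : t <> Var x.
    by move=> tx; apply: (red _ _ _ E1); exists QTrue => c; rewrite tx; apply: Reflexive.
  have xt : ~~ occ_term x t.
    by apply/negP => xt; apply: (red _ _ _ E1); exists QFalse => c; apply: OccursCheck.
  have xys : x \notin ys.
    apply/negP => xys.
    case: (norule (exs ys (conj (map (subst x t) P ++ QTrue :: map (subst x t) S)))).
    by rewrite E1; apply: Eliminate.
  split=> //.
    apply/negP => hx.
    case: (norule (exs ys (conj (map (subst x t) P ++ Eq (Var x) t :: map (subst x t) S)))).
    by rewrite E1; apply: Substitute.
  (* With [z] in the prefix and [x] outside it, [x = z] could be turned around. *)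
  move=> z tz; apply/negP => zys.
  case: (norule (exs ys (conj (P ++ Eq (Var z) (Var x) :: S)))).
  rewrite E1 tz; apply: Orient => //; right; exists x; split=> //.
  by move=> xz; rewrite xz zys in xys.
have solvedE E1 x t E2 : E' = E1 ++ (x, t) :: E2 ->
    [/\ ~~ occ_term x t, x \notin ys, forall z, t = Var z -> z \notin ys &
      [/\ x \notin map fst (E1 ++ E2), ~~ has (occ_term x) (map snd (E1 ++ E2)) &
       ~~ has (free x) As]].
  move=> E1E; have [|xt xys xPS tz] := solved (equations E1) x t (equations E2 ++ As).
    by rewrite El EE E1E /equations map_cat -catA.
  split=> //; move: xPS; rewrite catA /equations -map_cat has_cat.
  by rewrite has_free_equations !negb_or => /andP[/andP[-> ->] ->].
have [uys fys] := bound _ aM.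
exists ys, E', As; rewrite -/(equations E') -EE -El; split=> //.
- rewrite cat_uniq uys andbT; apply/andP; split.
    by apply: uniq_fst => E1 x t E2 /solvedE[_ _ _ []].
  apply/hasPn => x xys; apply/negP => /mem_fst_split[E1 [t [E2 /solvedE[_]]]].
  by rewrite xys.
- move=> x /mem_fst_split[E1 [t [E2 E1E]]].
  have [xt _ _ [_ xs xA]] := solvedE _ _ _ _ E1E.
  rewrite xA andbT E1E; move: xs; rewrite !map_cat !has_cat /= !negb_or xt.
  by case/andP=> -> ->.
(* [E'] is split at its [i]-th pair; the default pair is never reached because [i < size E']. *)
move=> z i zys iE tz; have := solvedE (take i E') (nth (0, Var 0) E' i).1
  (nth (0, Var 0) E' i).2 (drop i.+1 E').
rewrite -surjective_pairing -drop_nth // cat_take_drop => /(_ erefl) [_ _ /(_ z)].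
rewrite (nth_map (0, Var 0)) // in tz.
by move=> /(_ tz); rewrite zys.
Qed.

End Returned.

Theorem theorem3p1 (L : language) (Q : query L) :
  (~ exists r : nat -> query L,
       r 0 = Q /\ forall n : nat, alg_step (r n) (r n.+1)) /\
  (forall Q' : query L, run Q Q' -> returned Q' ->
     solved_form Q' /\
     (equivq Q' Q \/
      [/\ Q' = QFalse, 0 < natoms Q & unsatisfiable Q])).
Proof.
split=> [[r [_ step]]|Q' runQ ret]; first exact: alg_step_terminates step.
split; first exact: returned_solved_form.
by case: (run_sound runQ) => [/sem_eq_equivq|]; [left|right].
Qed.
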